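(* Let $k,m\geq 1$ be integers, and let $a\colon\mathbb{T}^k\to\mathbb{R}^m$ and $b\colon\mathbb{T}^m\to\mathbb{R}^m$ be mappings of class $A$. Assume that $b$ coincides with a non-degenerate affine mapping in some domain $J\subseteq[-\pi,\pi]^m$; that is, there are a real $m\times m$ matrix $P$ with $\det P\neq 0$ and a vector $y_0\in\mathbb{R}^m$ such that $b(y)=Py+y_0$ for all $y\in J$. Let $\varphi\colon\mathbb{T}^{k+m}\to\mathbb{R}$ be the function defined as the inner product $\varphi(x,y)=(a(x),b(y))$ for $x\in\mathbb{T}^k$, $y\in\mathbb{T}^m$. Let $W=a(\mathbb{T}^k)\subset\mathbb{R}^m$ be the image of $\mathbb{T}^k$ under $a$. Then $$\|e^{i\lambda\varphi}\|_{A(\mathbb{T}^{k+m})}\gtrsim N_W(1/|\lambda|),\qquad \lambda\in\mathbb{R},\ |\lambda|\to\infty;$$ that is, there exist constants $c>0$ and $\lambda_0>0$, independent of $\lambda$, such that $\|e^{i\lambda\varphi}\|_{A(\mathbb{T}^{k+m})}\geq c\,N_W(1/|\lambda|)$ for all $\lambda\in\mathbb{R}$ with $|\lambda|\geq\lambda_0$.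
   Context: $\mathbb{T}^d=\mathbb{R}^d/(2\pi\mathbb{Z})^d$; functions on $\mathbb{T}^d$ are identified with functions on $\mathbb{R}^d$ that are $2\pi$-periodic in each variable. $(\cdot,\cdot)$ is the Euclidean inner product. A domain is a nonempty connected open set. For a function $f$ on $\mathbb{T}^d$, $\widehat f(n)=\frac{1}{(2\pi)^d}\int_{\mathbb{T}^d}f(t)e^{-i(n,t)}\,dt$, $n\in\mathbb{Z}^d$. $A(\mathbb{T}^d)$ is the space of all continuous (complex-valued) functions $f$ on $\mathbb{T}^d$ with $\|f\|_{A(\mathbb{T}^d)}=\sum_{n\in\mathbb{Z}^d}|\widehat f(n)|<\infty$; it is a Banach algebra under pointwise multiplication. A mapping $s=(s_1,\dots,s_q)\colon\mathbb{T}^p\to\mathbb{R}^q$ is of class $A$ if all its coordinate functions $s_j\colon\mathbb{T}^p\to\mathbb{R}$ belong to $A(\mathbb{T}^p)$. (Under the hypotheses $\varphi\in A(\mathbb{T}^{k+m})$, hence $e^{i\lambda\varphi}\in A(\mathbb{T}^{k+m})$ for all $\lambda\in\mathbb{R}$.) For a bounded set $F\subset\mathbb{R}^m$ and $\varepsilon>0$, the covering number $N_F(\varepsilon)$ is the smallest number of balls (in $\mathbb{R}^m$) of radius $\varepsilon$ needed to cover $F$. *)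

(* Defs.v *)
From mathcomp Require Export all_boot all_order all_algebra.
From mathcomp Require Export complex.
From mathcomp Require Export all_classical all_reals all_analysis.

Set Implicit Arguments.
Unset Strict Implicit.
Unset Printing Implicit Defensive.

Import Order.TTheory GRing.Theory Num.Theory.
Import numFieldTopology.Exports numFieldNormedType.Exports.
Import ComplexField.

Local Open Scope classical_set_scope.
Local Open Scope ring_scope.
Local Open Scope complex_scope.

(* Points of R^d are column vectors 'cV[R]_d.  The instances on matrices give
   the product topology, but the norm |v| is the sup norm; the Euclidean
   structure is therefore spelled out here. *)
Definition dotv (R : realType) (d : nat) (u v : 'cV[R]_d) : R :=
  \sum_(j < d) u j 0 * v j 0.

Definition enorm (R : realType) (d : nat) (v : 'cV[R]_d) : R :=
  Num.sqrt (dotv v v).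

Definition eball (R : realType) (d : nat) (c : 'cV[R]_d) (r : R) :
    set 'cV[R]_d :=
  [set y | enorm (y - c) < r].

Definition covered_by (R : realType) (d : nat) (F : set 'cV[R]_d) (eps : R)
    (N : nat) : Prop :=
  exists c : 'I_N -> 'cV[R]_d, F `<=` \bigcup_i eball (c i) eps.

(* The infimum of a set of natural numbers is attained when this set is not
   empty, so this is the smallest number of balls when F is bounded and
   0 < eps; it is +oo if no finite cover exists. *)
Definition covering_number (R : realType) (d : nat) (F : set 'cV[R]_d)
    (eps : R) : \bar R :=
  ereal_inf [set N%:R%:E | N in [set N : nat | covered_by F eps N]].

(* A function on T^d = R^d / (2 pi Z)^d is a 2pi-periodic function on R^d. *)
Definition periodic2pi (R : realType) (T : Type) (d : nat)
    (f : 'cV[R]_d -> T) : Prop :=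
  forall (x : 'cV[R]_d) (j : 'I_d), f (x + (2 * pi) *: delta_mx j 0) = f x.

(* Integral over the cube [-pi, pi]^d as an iterated Lebesgue integral, the
   outermost one being over the first coordinate.  It is only used for
   continuous functions, for which it is the integral with respect to
   d-dimensional Lebesgue measure by Fubini's theorem. *)
Fixpoint torus_Rintegral (R : realType) (d : nat) : ('cV[R]_d -> R) -> R :=
  match d with
  | 0 => fun f => f 0
  | d'.+1 => fun f =>
      \int[@lebesgue_measure R]_(t in `[- pi, pi])
        torus_Rintegral (fun x : 'cV[R]_d' => f (col_mx t%:M x : 'cV[R]_(1 + d')))
  end.

Definition torus_integral (R : realType) (d : nat) (f : 'cV[R]_d -> R[i]) :
    R[i] :=
  torus_Rintegral (fun t => complex.Re (f t)) +i*
  torus_Rintegral (fun t => complex.Im (f t)).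

(* expi x = e^{ix} *)
Definition expi (R : realType) (x : R) : R[i] := cos x +i* sin x.

Definition fourier_coef (R : realType) (d : nat) (f : 'cV[R]_d -> R[i])
    (n : 'cV[int]_d) : R[i] :=
  (((2 * pi) ^+ d)^-1)%:C *
  torus_integral (fun t => f t * expi (- dotv (map_mx intr n) t)).

(* Normc.normc is the modulus as an element of R, whereas `|z| has type R[i]. *)
Definition A_norm (R : realType) (d : nat) (f : 'cV[R]_d -> R[i]) : \bar R :=
  \esum_(n in [set: 'cV[int]_d]) (Normc.normc (fourier_coef f n))%:E.

(* The cast to numFieldType selects the norm topology of R[i]. *)
Definition in_A (R : realType) (d : nat) (f : 'cV[R]_d -> R[i]) : Prop :=
  [/\ periodic2pi f,
      continuous (f : 'cV[R]_d -> (R[i] : numFieldType)) &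
      (A_norm f < +oo)%E].

Definition of_class_A (R : realType) (p q : nat) (s : 'cV[R]_p -> 'cV[R]_q) :
    Prop :=
  forall j : 'I_q, in_A (fun x => (s x j 0)%:C).

Definition domain (R : realType) (d : nat) (J : set 'cV[R]_d) : Prop :=
  [/\ J !=set0, open J & connected J].

Definition phase (R : realType) (k m : nat) (a : 'cV[R]_k -> 'cV[R]_m)
    (b : 'cV[R]_m -> 'cV[R]_m) (z : 'cV[R]_(k + m)) : R :=
  dotv (a (usubmx z)) (b (dsubmx z)).

(* Main.v *)
Require Import Defs.
From mathcomp Require Import all_boot all_order all_algebra.
From mathcomp Require Import complex.
From mathcomp Require Import all_classical all_reals all_analysis.
From mathcomp Require Import zify ring lra.

Import Order.TTheory GRing.Theory Num.Theory.
Import numFieldTopology.Exports numFieldNormedType.Exports.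

Local Open Scope classical_set_scope.
Local Open Scope ring_scope.

(** The proof is by duality: the function f = e^{i lambda phi} is tested against
    a finite measure mu for which the integral of f is large while all the
    Fourier coefficients of mu are small.

    Cut R^m into cubes of a fixed, small enough side and keep the cubes met by
    the image of v = lambda P^T a; let N be their number.  In each of them choose
    one point v_r = lambda P^T a (x_r).  Since P is invertible, the points x
    whose v falls into a given cube have a (x) in a ball of radius 1 / |lambda|,
    so N is at least the covering number.  Near a point c of J, where b is affine,
    place the tent-like discrete measure carried by the points
    y = c + h (p - q), where p and q run over the box {0, ..., M}^m, and let mu
    be the sum of the unit masses at (x_r, y), each multiplied by the conjugate
    of f there.  As f is unimodular, the integral of f with respect to mu is
    N (M + 1)^(2m).  On the other hand, for y near c the phase at (x_r, y) is
    v_r . y up to a constant, so the coefficient of mu at a frequency (n, l) is at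
    most the sum over r of |D (l - v_r)|^2, where D is a product of m Dirichlet
    sums.  Each factor decays quadratically and the v_r lie in different cubes,
    so this sum is bounded by a constant times (M + 1)^(2m), the constant
    depending only on m, on the side of the cubes and on the size of the
    neighbourhood of c ([dirichlet_cells]).

    The pairing of f with mu is bounded by the A-norm of f times the largest
    coefficient of mu.  This is proved by way of the Fejér means of f: they are
    trigonometric polynomials whose coefficients are those of f times weights in
    [0, 1], so the inequality holds for them term by term ([fejer_duality]), and
    they converge to f uniformly ([fejer_approx]).  The convergence rests on the
    kernel being nonnegative and of mass 1 and on the exact value of its moments
    against 1 - cos u_j, because |f (t) - f (z)| is at most e plus a multiple of
    the sum of the 1 - cos (z_j - t_j) ([modulus_by_cos]).  The Fejér mean has to
    be chosen before M, since the Dirichlet sums decay only on a range of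
    frequencies proportional to M; this is why the convergence must be uniform
    and not just pointwise. *)

Set Implicit Arguments.
Unset Strict Implicit.
Unset Printing Implicit Defensive.

Local Open Scope complex_scope.
Local Notation normc := Normc.normc.

(** * Complex numbers and the exponential *)

Section ComplexFacts.
Context {R : realType}.
Implicit Types (x y : R) (u v : R[i]).

Lemma complexP u v :
  complex.Re u = complex.Re v -> complex.Im u = complex.Im v -> u = v.
Proof. by case: u v => [a b] [c d] /= -> ->. Qed.

Lemma cReD u v : complex.Re (u + v) = complex.Re u + complex.Re v.
Proof. by case: u v => [a b] [c d]. Qed.
Lemma cImD u v : complex.Im (u + v) = complex.Im u + complex.Im v.
Proof. by case: u v => [a b] [c d]. Qed.
Lemma cReB u v : complex.Re (u - v) = complex.Re u - complex.Re v.
Proof. by case: u v => [a b] [c d]. Qed.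
Lemma cImB u v : complex.Im (u - v) = complex.Im u - complex.Im v.
Proof. by case: u v => [a b] [c d]. Qed.
Lemma cReM u v : complex.Re (u * v) =
  complex.Re u * complex.Re v - complex.Im u * complex.Im v.
Proof. by case: u v => [a b] [c d]. Qed.
Lemma cImM u v : complex.Im (u * v) =
  complex.Re u * complex.Im v + complex.Im u * complex.Re v.
Proof. by case: u v => [a b] [c d]. Qed.
Lemma cRe_sum (I : finType) (F : I -> R[i]) :
  complex.Re (\sum_i F i) = \sum_i complex.Re (F i).
Proof. by apply: (big_morph _ cReD). Qed.
Lemma cIm_sum (I : finType) (F : I -> R[i]) :
  complex.Im (\sum_i F i) = \sum_i complex.Im (F i).
Proof. by apply: (big_morph _ cImD). Qed.

Lemma normc_ge0 u : 0 <= normc u.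
Proof. by case: u => a b; exact: sqrtr_ge0. Qed.

Lemma normc_triangle u v : normc (u + v) <= normc u + normc v.
Proof. exact: le_normcD. Qed.

Lemma normc_sum (I : finType) (F : I -> R[i]) :
  normc (\sum_i F i) <= \sum_i normc (F i).
Proof.
elim/big_ind2 : _ => [|u x v y ux vy|//]; first by rewrite Normc.normc0.
exact: le_trans (normc_triangle _ _) (lerD ux vy).
Qed.

Lemma normc_real x : normc x%:C = `|x|.
Proof. by rewrite /= expr0n addr0 sqrtr_sqr. Qed.

Lemma normr_Im_le u : `|complex.Im u| <= normc u.
Proof. by case: u => a b /=; rewrite -sqrtr_sqr ler_wsqrtr// lerDr sqr_ge0. Qed.

Lemma normc_le_ReIm u : normc u <= `|complex.Re u| + `|complex.Im u|.
Proof.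
case: u => a b /=; rewrite -[leRHS]ger0_norm ?addr_ge0// -sqrtr_sqr.
rewrite ler_wsqrtr// sqrrD !real_normK ?num_real// lerD2r lerDl.
by rewrite mulrn_wge0// mulr_ge0.
Qed.

Lemma mulc_conj u : u * u^*%C = (normc u ^+ 2)%:C.
Proof.
case: u => a b; apply: complexP; rewrite ?cReM ?cImM /=; last by ring.
by rewrite sqr_sqrtr ?addr_ge0 ?sqr_ge0//; ring.
Qed.

Lemma expi0 : expi 0 = 1 :> R[i].
Proof. by rewrite /expi cos0 sin0. Qed.

Lemma expiD x y : expi (x + y) = expi x * expi y.
Proof. by apply: complexP; rewrite ?cReM ?cImM /= ?cosD ?sinD //; ring. Qed.

Lemma expiN x : expi (- x) = (expi x)^*%C.
Proof. by apply: complexP; rewrite /= ?cosN ?sinN. Qed.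

Lemma normc_expi x : normc (expi x) = 1.
Proof. by rewrite /= cos2Dsin2 sqrtr1. Qed.

Lemma expi_sum (I : finType) (F : I -> R) :
  expi (\sum_i F i) = \prod_i expi (F i).
Proof. exact: (big_morph _ expiD expi0). Qed.

Lemma expiMn x n : expi (x * n%:R) = expi x ^+ n.
Proof.
elim: n => [|n IH]; first by rewrite mulr0 expi0.
by rewrite -addn1 natrD mulrDr mulr1 expiD IH exprD.
Qed.

End ComplexFacts.

(** * Trigonometric estimates and integrals *)

Section Trig.
Context {R : realType}.
Implicit Types (x y t : R).

Lemma is_derive_bounded_lipschitz (f df : R -> R) :
  (forall x, is_derive x 1 f (df x)) -> (forall x, `|df x| <= 1) ->
  forall x y, `|f x - f y| <= `|x - y|.
Proof.
move=> fd dfb x y; wlog: x y / y < x => [H|yx].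
  have [/H//|xy|->] := ltgtP y x; last by rewrite !subrr.
  by rewrite distrC [leRHS]distrC; exact: H.
have [//|c _ ->] := MVT yx (fun z _ => fd z).
  by apply: derivable_within_continuous => z _; exact: (@ex_derive _ _ _ _ _ _ _ (fd z)).
by rewrite normrM ler_piMl.
Qed.

Lemma cos_lipschitz x y : `|cos x - cos y| <= `|x - y|.
Proof.
apply: (@is_derive_bounded_lipschitz _ (fun x => - sin x)) => z.
by rewrite normrN sin_max.
Qed.

Lemma sin_lipschitz x y : `|sin x - sin y| <= `|x - y|.
Proof. by apply: (@is_derive_bounded_lipschitz _ cos) => z; exact: cos_max. Qed.

(** By the mean value theorem, since cos is 1-Lipschitz and hence at least
    1/2 on [0, 1/2]. *)
Lemma sin_ge_half x : `|x| <= 2^-1 -> `|x| / 2 <= `|sin x|.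
Proof.
wlog x0 : x / 0 < x => [H|].
  have [/H//|x0|<-] := ltgtP 0 x; last by rewrite normr0 mul0r.
  by rewrite -normrN => /H; rewrite sinN !normrN oppr_gt0; exact.
rewrite gtr0_norm// => x2.
have [//|c /andP[c0 cx]] := MVT x0 (fun z _ => is_derive_sin z).
  by apply: derivable_within_continuous => z _; exact: derivable_sin.
rewrite !bnd_simp in c0 cx; rewrite sin0 !subr0 => ->.
have cge : 2^-1 <= cos c.
  have := cos_lipschitz 0 c; rewrite cos0 sub0r normrN (gtr0_norm c0).
  rewrite ler_norml; lra.
by rewrite ger0_norm mulrC ?ler_wpM2r//; nra.
Qed.

Lemma one_sub_expi_ge x : `|x| <= 2^-1 -> `|x| / 2 <= normc (1 - expi x).
Proof.
move=> /sin_ge_half/le_trans; apply; rewrite -normrN.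
have -> : - sin x = complex.Im (1 - expi x) by rewrite cImB /= sub0r.
exact: normr_Im_le.
Qed.

Lemma trig_periodZ (n : int) x : 
  (cos (x + (2 * pi) * n%:~R) = cos x) * (sin (x + (2 * pi) * n%:~R) = sin x).
Proof.
have H (k : nat) y :
    (cos (y + (2 * pi) * k%:R) = cos y) * (sin (y + (2 * pi) * k%:R) = sin y).
  have -> : 2 * pi * k%:R = (pi *+ 2) *+ k :> R.
    by rewrite mulr_natr mulr_natl.
  by rewrite (periodicn (@cosD2pi R)) (periodicn (@sinD2pi R)).
case: n => k; first exact: H.
set u := x + _; have -> : x = u + 2 * pi * k.+1%:R.
  by rewrite /u NegzE mulrNz mulrN subrK.
by rewrite !H.
Qed.

Lemma continuous_Rintegrable (f : R -> R) (a b : R) : continuous f ->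
  (@lebesgue_measure R).-integrable `[a, b] (EFin \o f).
Proof.
move=> cf; apply: continuous_compact_integrable; first exact: segment_compact.
exact: continuous_subspaceT.
Qed.

Lemma Rintegral_derive (f F : R -> R) (a b : R) : a < b ->
  continuous f -> (forall x, is_derive x 1 F (f x)) ->
  \int[@lebesgue_measure R]_(t in `[a, b]) f t = F b - F a.
Proof.
move=> ab cf dF; have cF : continuous F.
  move=> z; apply/differentiable_continuous/derivable1_diffP.
  exact: (@ex_derive _ _ _ _ _ _ _ (dF z)).
rewrite /Rintegral (continuous_FTC2 (F := F))//=.
- exact: continuous_subspaceT.
- split=> [z _||]; first exact: (@ex_derive _ _ _ _ _ _ _ (dF z)).
  + by apply: cvg_at_right_filter; exact: cF.
  + by apply: cvg_at_left_filter; exact: cF.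
- by move=> z _; rewrite derive1E; exact: (@derive_val _ _ _ _ _ _ _ (dF z)).
Qed.

Lemma Rintegral_cos_int (n : int) :
  \int[@lebesgue_measure R]_(t in `[- pi, pi]) cos (n%:~R * t) =
  if n == 0 then 2 * pi else 0.
Proof.
have pi0 := @pi_gt0 R; have lt : - pi < pi :> R by lra.
case: eqVneq => [->|n0].
  under eq_Rintegral do rewrite mul0r cos0.
  rewrite Rintegral_cst//= mul1r lebesgue_measure_itv/= lte_fin lt /=.
  ring.
have n0' : n%:~R != 0 :> R by rewrite intr_eq0.
have dF t : is_derive t 1 (fun t => n%:~R^-1 * sin (n%:~R * t)) (cos (n%:~R * t)).
  apply: is_derive_eq.
  by rewrite /GRing.scale/=; field.
have cf : continuous (fun s : R => cos (n%:~R * s)).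
  move=> s; apply: continuous_comp; last exact: continuous_cos.
  by apply: cvgM; [exact: cvg_cst|exact: cvg_id].
rewrite (Rintegral_derive lt cf dF).
have -> : n%:~R * pi = n%:~R * (- pi) + 2 * pi * n%:~R :> R by ring.
by rewrite trig_periodZ subrr.
Qed.

Lemma Rintegral_sin_int (n : int) :
  \int[@lebesgue_measure R]_(t in `[- pi, pi]) sin (n%:~R * t) = 0.
Proof.
have pi0 := @pi_gt0 R; have lt : - pi < pi :> R by lra.
have [->|n0] := eqVneq n 0.
  under eq_Rintegral do rewrite mul0r sin0.
  by rewrite Rintegral_cst// mul0r.
have n0' : n%:~R != 0 :> R by rewrite intr_eq0.
have dF t : is_derive t 1 (fun t => - n%:~R^-1 * cos (n%:~R * t)) (sin (n%:~R * t)).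
  apply: is_derive_eq.
  by rewrite /GRing.scale/=; field.
have cf : continuous (fun s : R => sin (n%:~R * s)).
  move=> s; apply: continuous_comp; last exact: continuous_sin.
  by apply: cvgM; [exact: cvg_cst|exact: cvg_id].
rewrite (Rintegral_derive lt cf dF).
have -> : n%:~R * pi = n%:~R * (- pi) + 2 * pi * n%:~R :> R by ring.
by rewrite trig_periodZ subrr.
Qed.

End Trig.

(** * The iterated integral of bounded uniformly continuous functions *)

Section BUC.
Context {R : realType}.

Definition unif_cont d (f : 'cV[R]_d -> R) :=
  forall e : R, 0 < e -> exists2 r : R, 0 < r &
    forall x y : 'cV[R]_d, (forall j, `|x j 0 - y j 0| <= r) -> `|f x - f y| <= e.

(** Bounded and uniformly continuous functions.  Distances are measured
    coordinatewise, so that a modulus of continuity passes to sections and, after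
    integration of the other variables, to the first variable. *)
Definition buc d (f : 'cV[R]_d -> R) :=
  (exists M, forall x, `|f x| <= M) /\ unif_cont f.

Lemma unif_cont_lipschitz d (f : 'cV[R]_d -> R) (g : R -> R) :
  (forall s t, `|g s - g t| <= `|s - t|) -> unif_cont f -> unif_cont (g \o f).
Proof.
move=> gl uf e e0; have [r r0 fr] := uf e e0; exists r => // x y /fr.
exact: le_trans (gl _ _).
Qed.

Lemma buc_lipschitz d (f : 'cV[R]_d -> R) (g : R -> R) M :
  (forall s, `|g s| <= M) ->
  (forall s t, `|g s - g t| <= `|s - t|) -> unif_cont f -> buc (g \o f).
Proof.
by move=> gM gl uf; split; [exists M => x; exact: gM|exact: unif_cont_lipschitz].
Qed.

Lemma unif_cont_cst d (c : R) : unif_cont (fun _ : 'cV[R]_d => c).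
Proof. by move=> e e0; exists 1 => // x y _; rewrite subrr normr0 ltW. Qed.

Lemma unif_contD d (f g : 'cV[R]_d -> R) :
  unif_cont f -> unif_cont g -> unif_cont (fun x => f x + g x).
Proof.
move=> uf ug e e0; have e20 : 0 < e / 2 by lra.
have [r r0 fr] := uf _ e20; have [s s0 gs] := ug _ e20.
exists (Num.min r s) => [|x y xy]; first by rewrite lt_min r0.
have [H1 H2] : `|g x - g y| <= e / 2 /\ `|f x - f y| <= e / 2.
  by split; [apply: gs|apply: fr] => j; apply: le_trans (xy j) _;
     rewrite ge_min lexx ?orbT.
have -> : f x + g x - (f y + g y) = (f x - f y) + (g x - g y) by ring.
by apply: le_trans (ler_normD _ _) _; lra.
Qed.

Lemma unif_cont_sum d (I : finType) (F : I -> 'cV[R]_d -> R) :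
  (forall i, unif_cont (F i)) -> unif_cont (fun x => \sum_i F i x).
Proof.
move=> uF; have : forall s : seq I, unif_cont (fun x => \sum_(i <- s) F i x).
  elim=> [|i s IH].
    rewrite (_ : (fun x => _) = fun=> 0); first exact: unif_cont_cst.
    by apply/funext => x; rewrite big_nil.
  rewrite (_ : (fun x => _) = fun x => F i x + \sum_(i <- s) F i x).
    exact: unif_contD.
  by apply/funext => x; rewrite big_cons.
by move=> /(_ (index_enum I)).
Qed.

Lemma unif_cont_coord d (j : 'I_d) : unif_cont (fun x : 'cV[R]_d => x j 0).
Proof. by move=> e e0; exists e. Qed.

Lemma buc_cst d (c : R) : buc (fun _ : 'cV[R]_d => c).
Proof. by split; [exists (`|c|) => x|exact: unif_cont_cst]. Qed.

Lemma bucD d (f g : 'cV[R]_d -> R) : buc f -> buc g -> buc (fun x => f x + g x).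
Proof.
move=> [[M fM] uf] [[N gN] ug]; split; last exact: unif_contD.
by exists (M + N) => x; apply: le_trans (ler_normD _ _) (lerD _ _).
Qed.

Lemma bucM d (f g : 'cV[R]_d -> R) : buc f -> buc g -> buc (fun x => f x * g x).
Proof.
move=> [[M fM] uf] [[N gN] ug]; split.
  by exists (M * N) => x; rewrite normrM ler_pM.
have M0 : 0 <= M by exact: le_trans (normr_ge0 _) (fM 0).
have N0 : 0 <= N by exact: le_trans (normr_ge0 _) (gN 0).
move=> e e0; have e1 : 0 < e / (M + N + 1) by rewrite divr_gt0//; lra.
have [r r0 fr] := uf _ e1; have [s s0 gs] := ug _ e1.
exists (Num.min r s) => [|x y xy]; first by rewrite lt_min r0.
have [H1 H2] : `|g x - g y| <= e / (M + N + 1) /\ `|f x - f y| <= e / (M + N + 1).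
  by split; [apply: gs|apply: fr] => j; apply: le_trans (xy j) _;
     rewrite ge_min lexx ?orbT.
have -> : f x * g x - f y * g y = (f x - f y) * g x + f y * (g x - g y) by ring.
apply: le_trans (ler_normD _ _) _; rewrite !normrM.
apply: le_trans (_ : e / (M + N + 1) * N + M * (e / (M + N + 1)) <= e).
  by apply: lerD; apply: ler_pM.
have -> : e / (M + N + 1) * N + M * (e / (M + N + 1)) =
  e / (M + N + 1) * (M + N + 1) - e / (M + N + 1) by ring.
rewrite divfK; last by apply: lt0r_neq0; lra.
lra.
Qed.

Lemma bucZ d (c : R) (f : 'cV[R]_d -> R) : buc f -> buc (fun x => c * f x).
Proof. by move=> bf; apply: bucM => //; exact: buc_cst. Qed.

Lemma bucN d (f : 'cV[R]_d -> R) : buc f -> buc (fun x => - f x).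
Proof.
move=> /(bucZ (-1)); rewrite (_ : (fun x => _) = fun x => - f x)//.
by apply/funext => x; rewrite mulN1r.
Qed.

Lemma buc_sum d (I : finType) (F : I -> 'cV[R]_d -> R) :
  (forall i, buc (F i)) -> buc (fun x => \sum_i F i x).
Proof.
move=> uF; split; last by apply: unif_cont_sum => i; case: (uF i).
have /choice[M FM] : forall i, exists M, forall x, `|F i x| <= M.
  by move=> i; case: (uF i).
exists (\sum_i M i) => x; apply: le_trans (ler_norm_sum _ _ _) _.
exact: ler_sum.
Qed.

Lemma unif_cont_dotv d (u : 'cV[R]_d) : unif_cont (dotv u).
Proof.
apply: unif_cont_sum => j e e0; exists (e / (`|u j 0| + 1)) => [|x y /(_ j) xy].
  by rewrite divr_gt0// ltr_wpDl.
rewrite -mulrBr normrM; apply: le_trans (ler_wpM2l (normr_ge0 _) xy) _.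
rewrite mulrA ler_pdivrMr ?ltr_wpDl// mulrC ler_pM2l//; lra.
Qed.

Lemma buc_cos d (f : 'cV[R]_d -> R) : unif_cont f -> buc (fun x => cos (f x)).
Proof. by apply: (buc_lipschitz (M := 1)); [exact: cos_max|exact: cos_lipschitz]. Qed.

Lemma buc_sin d (f : 'cV[R]_d -> R) : unif_cont f -> buc (fun x => sin (f x)).
Proof. by apply: (buc_lipschitz (M := 1)); [exact: sin_max|exact: sin_lipschitz]. Qed.

Lemma col_mx_dist d (s t r : R) (x y : 'cV[R]_d) :
  `|s - t| <= r -> (forall j, `|x j 0 - y j 0| <= r) ->
  forall j, `|(col_mx s%:M x : 'cV_(1 + d)) j 0 - (col_mx t%:M y : 'cV_(1 + d)) j 0| <= r.
Proof.
move=> st xy j; case: (split_ordP j) => i ->.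
  by rewrite !col_mxEu ord1 !mxE.
by rewrite !col_mxEd.
Qed.

Lemma buc_section d (f : 'cV[R]_(1 + d) -> R) t :
  buc f -> buc (fun x : 'cV[R]_d => f (col_mx t%:M x)).
Proof.
move=> [[M fM] uf]; split; first by exists M.
move=> e e0; have [r r0 fr] := uf _ e0; exists r => // x y xy.
by apply: fr; apply: col_mx_dist => //; rewrite subrr normr0 ltW.
Qed.

(** Linearity, monotonicity and the value at constants are proved together
    because the continuity in the first variable of the inner integral, needed
    to integrate once more, follows from them in the lower dimension. *)
Let torus_props d :=
  [/\ forall (f g : 'cV[R]_d -> R) c, buc f -> buc g ->
        torus_Rintegral (fun x => f x + c * g x) =
        torus_Rintegral f + c * torus_Rintegral g,
      forall f g : 'cV[R]_d -> R, buc f -> buc g -> (forall x, f x <= g x) ->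
        torus_Rintegral f <= torus_Rintegral g &
      forall c : R, torus_Rintegral (fun _ : 'cV[R]_d => c) = c * (2 * pi) ^+ d].

Let section_continuous d (f : 'cV[R]_(1 + d) -> R) : torus_props d -> buc f ->
  continuous (fun t : R => torus_Rintegral (fun x : 'cV[R]_d => f (col_mx t%:M x))).
Proof.
move=> [lin mono cst] bf t; apply/cvgrPdist_le => e e0.
have P0 : 0 < (2 * pi : R) ^+ d by rewrite exprn_gt0// mulr_gt0// pi_gt0.
have e1 : 0 < e / (2 * pi) ^+ d by rewrite divr_gt0.
have [r r0 fr] := bf.2 _ e1.
near=> s.
have st : `|t - s| <= r by near: s; apply: cvgr_dist_le => //; exact: cvg_id.
have key u v : `|u - v| <= r ->
  torus_Rintegral (fun x : 'cV[R]_d => f (col_mx u%:M x)) -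
  torus_Rintegral (fun x : 'cV[R]_d => f (col_mx v%:M x)) <= e.
  move=> uv; rewrite -mulN1r -lin; try exact: buc_section.
  have -> : e = torus_Rintegral (fun _ : 'cV[R]_d => e / (2 * pi) ^+ d).
    by rewrite cst divfK// gt_eqF.
  apply: mono; last 1 first.
  - move=> x; rewrite mulN1r; apply: le_trans (ler_norm _) _; apply: fr.
    by apply: col_mx_dist => // j; rewrite subrr normr0 ltW.
  - by apply: bucD; [exact: buc_section|apply: bucZ; exact: buc_section].
  - exact: buc_cst.
rewrite ler_norml key// andbT lerNl opprB key// distrC//.
Unshelve. all: by end_near. Qed.

Lemma torus_Rintegral_props d : torus_props d.
Proof.
elim: d => [|d IH].
  split=> [//|f g _ _ fg|c]; [exact: fg|by rewrite expr0 mulr1].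
have [lin mono cst] := IH.
have sec (f : 'cV[R]_(1 + d) -> R) : buc f -> (@lebesgue_measure R).-integrable
   `[- pi, pi] (EFin \o (fun t : R =>
     torus_Rintegral (fun x : 'cV[R]_d => f (col_mx t%:M x)))).
  by move=> bf; apply/continuous_Rintegrable/section_continuous.
split=> [f g c bf bg|f g bf bg fg|c] /=.
- rewrite -RintegralZl//; last exact: sec.
  rewrite -RintegralD//; last 2 first.
  + exact: sec.
  + have /= := @sec (fun x => c * g x) (bucZ c bg); congr (integrable _ _ _).
    apply/funext => t /=; congr EFin.
    have := lin (fun x => 0) (fun x => g (col_mx t%:M x)) c (buc_cst _ _) (buc_section _ bg).
    by rewrite cst mul0r add0r => <-;
       congr torus_Rintegral; apply/funext => x; rewrite add0r.
  apply: eq_Rintegral => t _; apply: lin; exact: buc_section.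
- apply: le_Rintegral => //; [exact: sec|exact: sec|].
  by move=> t _; apply: mono => //; exact: buc_section.
- rewrite Rintegral_cst//= lebesgue_measure_itv/= lte_fin.
  have pi0 := @pi_gt0 R; have -> : - pi < pi :> R by lra.
  by rewrite cst exprSr /=; ring.
Qed.

Lemma torus_Rintegral_lin d (f g : 'cV[R]_d -> R) c : buc f -> buc g ->
  torus_Rintegral (fun x => f x + c * g x) =
  torus_Rintegral f + c * torus_Rintegral g.
Proof. by case: (torus_Rintegral_props d) => lin _ _; exact: lin. Qed.

Lemma le_torus_Rintegral d (f g : 'cV[R]_d -> R) : buc f -> buc g ->
  (forall x, f x <= g x) -> torus_Rintegral f <= torus_Rintegral g.
Proof. by case: (torus_Rintegral_props d) => _ mono _; exact: mono. Qed.

Lemma torus_Rintegral_cst d (c : R) :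
  torus_Rintegral (fun _ : 'cV[R]_d => c) = c * (2 * pi) ^+ d.
Proof. by case: (torus_Rintegral_props d). Qed.

Lemma torus_RintegralZ d (f : 'cV[R]_d -> R) c : buc f ->
  torus_Rintegral (fun x => c * f x) = c * torus_Rintegral f.
Proof.
move=> bf; have := torus_Rintegral_lin c (buc_cst _ 0) bf.
by rewrite torus_Rintegral_cst mul0r add0r => <-;
       congr torus_Rintegral; apply/funext => x; rewrite add0r.
Qed.

Lemma torus_RintegralD d (f g : 'cV[R]_d -> R) : buc f -> buc g ->
  torus_Rintegral (fun x => f x + g x) = torus_Rintegral f + torus_Rintegral g.
Proof.
move=> bf bg; have := torus_Rintegral_lin 1 bf bg; rewrite mul1r => <-.
by congr torus_Rintegral; apply/funext => x; rewrite mul1r.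
Qed.

Lemma torus_Rintegral_sum d (I : finType) (F : I -> 'cV[R]_d -> R) :
  (forall i, buc (F i)) ->
  torus_Rintegral (fun x => \sum_i F i x) = \sum_i torus_Rintegral (F i).
Proof.
move=> bF; suff H (s : seq I) : buc (fun x => \sum_(i <- s) F i x) /\
    torus_Rintegral (fun x => \sum_(i <- s) F i x) =
    \sum_(i <- s) torus_Rintegral (F i) by case: (H (index_enum I)).
elim: s => [|i s [IH1 IH2]].
  rewrite big_nil (_ : (fun x => _) = fun=> 0).
    by rewrite torus_Rintegral_cst mul0r; split => //; exact: buc_cst.
  by apply/funext => x; rewrite big_nil.
rewrite big_cons (_ : (fun x => _) = fun x => F i x + \sum_(i <- s) F i x).
  by rewrite torus_RintegralD// IH2; split => //; exact: bucD.
by apply/funext => x; rewrite big_cons.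
Qed.

Lemma normr_torus_Rintegral_le d (f g : 'cV[R]_d -> R) : buc f -> buc g ->
  (forall x, `|f x| <= g x) -> `|torus_Rintegral f| <= torus_Rintegral g.
Proof.
move=> bf bg fg; rewrite ler_norml -[- _]mulN1r -torus_RintegralZ//.
apply/andP; split; apply: le_torus_Rintegral => //; try exact: bucZ.
  by move=> x; rewrite mulN1r; have := fg x; rewrite ler_norml => /andP[].
by move=> x; exact: le_trans (ler_norm _) (fg x).
Qed.

(** Orthogonality of characters, by induction on the dimension: the addition
    formulas separate the first variable from the others. *)
Lemma torus_Rintegral_char d (n : 'cV[int]_d) :
  (torus_Rintegral (fun t => cos (dotv (map_mx intr n) t)) =
    if n == 0 then (2 * pi : R) ^+ d else 0) *
  (torus_Rintegral (fun t : 'cV[R]_d => sin (dotv (map_mx intr n) t)) = 0).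
Proof.
elim: d n => [|d IH] n /=.
  by rewrite /dotv big_ord0 cos0 sin0 (flatmx0 n) eqxx.
rewrite -[n](@vsubmxK _ 1 d).
set n0 := usubmx _; set n' := dsubmx _.
have n00 : (n0 == 0) = (n0 0 0 == 0).
  by apply/eqP/eqP => [->|h]; rewrite ?mxE//; apply/colP => i; rewrite ord1 h mxE.
have dotE t (x : 'cV[R]_d) : dotv (map_mx intr (col_mx n0 n')) (col_mx t%:M x) =
    (n0 0 0)%:~R * t + dotv (map_mx intr n') x.
  rewrite /dotv big_split_ord /= big_ord1.
  rewrite map_col_mx !col_mxEu !mxE eqxx mulr1n; congr (_ + _).
  by apply: eq_bigr => i _; rewrite !col_mxEd.
have bc : buc (fun x : 'cV[R]_d => cos (dotv (map_mx intr n') x)).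
  by apply: buc_cos; exact: unif_cont_dotv.
have bs : buc (fun x : 'cV[R]_d => sin (dotv (map_mx intr n') x)).
  by apply: buc_sin; exact: unif_cont_dotv.
have E1 (t : R) : torus_Rintegral (fun x : 'cV[R]_d =>
    cos (dotv (map_mx intr (col_mx n0 n')) (col_mx t%:M x))) =
    (if n' == 0 then (2 * pi) ^+ d else 0) * cos ((n0 0 0)%:~R * t).
  rewrite (_ : (fun x => _) = fun x : 'cV[R]_d =>
    cos ((n0 0 0)%:~R * t) * cos (dotv (map_mx intr n') x) +
    (- sin ((n0 0 0)%:~R * t)) * sin (dotv (map_mx intr n') x)); last first.
    by apply/funext => x; rewrite dotE cosD mulNr.
  rewrite torus_Rintegral_lin//; last exact: bucZ.
  by rewrite torus_RintegralZ// !IH mulr0 addr0 mulrC.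
have E2 (t : R) : torus_Rintegral (fun x : 'cV[R]_d =>
    sin (dotv (map_mx intr (col_mx n0 n')) (col_mx t%:M x))) =
    (if n' == 0 then (2 * pi) ^+ d else 0) * sin ((n0 0 0)%:~R * t).
  rewrite (_ : (fun x => _) = fun x : 'cV[R]_d =>
    sin ((n0 0 0)%:~R * t) * cos (dotv (map_mx intr n') x) +
    cos ((n0 0 0)%:~R * t) * sin (dotv (map_mx intr n') x)); last first.
    by apply/funext => x; rewrite dotE sinD.
  rewrite torus_RintegralD//; try exact: bucZ.
  by rewrite !torus_RintegralZ// !IH mulr0 addr0 mulrC.
have int_c (g : R -> R) : continuous g -> (@lebesgue_measure R).-integrable
   `[- pi, pi] (EFin \o (fun t : R => g ((n0 0 0)%:~R * t))).
  move=> cg; apply: continuous_Rintegrable => t; apply: continuous_comp.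
    by apply: cvgM; [exact: cvg_cst|exact: cvg_id].
  exact: cg.
split.
  under eq_Rintegral do rewrite E1.
  rewrite RintegralZl//; last exact/int_c/continuous_cos.
  rewrite Rintegral_cos_int (_ : (col_mx n0 n' == 0) = (n0 0 0 == 0) && (n' == 0)).
    by case: (n' == 0); case: (n0 0 0 == 0); rewrite /= ?mulr0 ?mul0r ?exprSr.
  by rewrite col_mx_eq0 n00.
under eq_Rintegral do rewrite E2.
rewrite RintegralZl//; last exact/int_c/continuous_sin.
by rewrite Rintegral_sin_int mulr0.
Qed.

End BUC.

(** * Periodic continuous functions *)

Section Periodic.
Context {R : realType}.

Lemma periodic2piZ (T : Type) d (f : 'cV[R]_d -> T) (n : 'cV[int]_d) x :
  periodic2pi f -> f (x + (2 * pi) *: map_mx intr n) = f x.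
Proof.
move=> pf.
have H1 j (k : nat) y : f (y + (2 * pi * k%:R) *: delta_mx j 0) = f y.
  elim: k => [|k IH]; first by rewrite mulr0 scale0r addr0.
  by rewrite -(natr1 k) mulrDr mulr1 scalerDl addrA pf.
have H2 j (k : int) y : f (y + (2 * pi * k%:~R) *: delta_mx j 0) = f y.
  case: k => k; first exact: H1.
  rewrite NegzE mulrNz mulrN scaleNr; set u := _ *: _.
  by rewrite -[in RHS](subrK u y) H1.
have -> : map_mx intr n = \sum_j (n j 0)%:~R *: delta_mx j 0 :> 'cV[R]_d.
  rewrite [LHS]matrix_sum_delta; apply: eq_bigr => j _.
  by rewrite big_ord1 mxE.
rewrite scaler_sumr.
elim: (index_enum 'I_d) => [|j s IH]; first by rewrite big_nil addr0.
by rewrite big_cons addrCA addrC scalerA H2.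
Qed.

Lemma reduce_2pi (t : R) : exists n : int, `|t + 2 * pi * n%:~R| <= pi.
Proof.
have pi0 := @pi_gt0 R; have p2 : 0 < 2 * pi :> R by lra.
exists (- Num.floor ((t + pi) / (2 * pi))).
set n := Num.floor _.
have h1 : n%:~R <= (t + pi) / (2 * pi) by exact: floor_le.
have h2 : (t + pi) / (2 * pi) < (n + 1)%:~R by exact: floorD1_gt.
rewrite ler_pdivlMr// in h1; rewrite ltr_pdivrMr// rmorphD/= in h2.
by rewrite mulrNz ler_norml; lra.
Qed.

Lemma reduce_2piV d (x : 'cV[R]_d) : exists n : 'cV[int]_d,
  forall j, `|(x + (2 * pi) *: map_mx intr n) j 0| <= pi.
Proof.
have /choice[n nP] := fun j => reduce_2pi (x j 0).
by exists (\col_j n j) => j; rewrite !mxE; exact: nP.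
Qed.

Lemma continuous_coordP d (g : 'cV[R]_d -> R) : continuous g ->
  forall (x : 'cV[R]_d) (e : R), 0 < e -> exists2 r : R, 0 < r &
    forall y : 'cV[R]_d, (forall j, `|x j 0 - y j 0| < r) -> `|g x - g y| <= e.
Proof.
move=> cg x e e0; have /cvgrPdist_le/(_ e e0) := cg x.
move=> /nbhs_ballP[r /= r0 rP]; exists r => // y xy.
by apply: rP; split=> // i j; rewrite (ord1 j); exact: xy.
Qed.

(** Both properties hold near each point of the compact cube [-pi, pi]^d,
    hence on the whole cube by the covering formulation of compactness, and
    translation by the period lattice carries them to R^d. *)
Lemma periodic_continuous_buc d (g : 'cV[R]_d -> R) :
  periodic2pi g -> continuous g -> buc g.
Proof.
move=> pg cg; have pi0 := @pi_gt0 R.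
pose K := [set v : 'rV[R]_d | forall j, `[- pi, pi]%classic (v 0 j)].
have cK : near_covering K.
  apply/compact_near_coveringP/(@rV_compact _ _ (fun=> `[- pi, pi]%classic)) => _.
  exact: segment_compact.
have inK (x : 'cV[R]_d) : exists n : 'cV[int]_d,
    K (x + (2 * pi) *: map_mx intr n)^T.
  have [n nP] := reduce_2piV x; exists n => j.
  by rewrite mxE /= in_itv/= -ler_norml.
have nbhsP (v : 'rV[R]_d) (r : R) : 0 < r ->
    \forall v' \near v, forall j, `|v 0 j - (v' : 'rV[R]_d) 0 j| < r.
  by move=> r0; apply/nbhs_ballP; exists r => // w [_ vw] j; exact: vw.
split.
  have : \forall M \near +oo, K `<=` (fun v => `|g v^T| <= M).
    apply: (cK R +oo) => v _.
    have [r r0 rP] := continuous_coordP cg v^T ltr01.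
    near=> v' M => /=.
    have vv' : forall j, `|v 0 j - v' 0 j| < r by near: v'; exact: nbhsP.
    have v'P : `|g v^T - g v'^T| <= 1 by apply: rP => j; rewrite !mxE.
    apply: (@le_trans _ _ (`|g v^T| + 1)).
      rewrite -lerBlDl; apply: le_trans v'P; rewrite [leRHS]distrC.
      exact: lerB_dist.
    by near: M; exact: nbhs_pinfty_ge.
  move=> /filter_ex[M MP].
  exists M => x; have [n nP] := inK x.
  by rewrite -(periodic2piZ n x pg) -[X in g X]trmxK; exact: MP.
move=> e e0.
have : \forall r \near 0^'+, K `<=` (fun v : 'rV[R]_d =>
    forall w : 'cV[R]_d, (forall j, `|v 0 j - w j 0| <= r) -> `|g v^T - g w| <= e).
  apply: (cK R (0^'+)) => v _.
  have e20 : 0 < e / 2 by lra.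
  have [r r0 rP] := continuous_coordP cg v^T e20.
  have r20 : 0 < r / 2 by lra.
  near=> v' s => /= w v'w.
  have vv' : forall j, `|v 0 j - v' 0 j| < r / 2 by near: v'; exact: nbhsP.
  have sr : s < r / 2 by near: s; exact: nbhs_right_lt.
  have h1 : `|g v^T - g v'^T| <= e / 2.
    by apply: rP => j; rewrite !mxE; apply: lt_trans (vv' j) _; lra.
  have h2 : `|g v^T - g w| <= e / 2.
    apply: rP => j; rewrite !mxE.
    have := ler_distD (v' 0 j) (v 0 j) (w j 0); have := vv' j; have := v'w j; lra.
  rewrite distrC in h1.
  by have := ler_distD (g v^T) (g v'^T) (g w); lra.
move=> H.
have : \forall r \near 0^'+, 0 < r :> R by exact: nbhs_right_gt.
move=> /(filterI H)/filter_ex[r [rP r0]]; exists r => // x y xy.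
have [n nP] := inK x.
rewrite -(periodic2piZ n x pg) -(periodic2piZ n y pg) -[X in g X - _]trmxK.
by apply: rP => // j; rewrite !mxE opprD addrACA subrr addr0.
Unshelve. all: by end_near. Qed.

Lemma in_A_real_buc d (g : 'cV[R]_d -> R) : in_A (fun x => (g x)%:C) ->
  periodic2pi g /\ buc g.
Proof.
move=> [pg cg _].
have pg' : periodic2pi g by move=> x j; case: (pg x j).
split=> //; apply: periodic_continuous_buc => // x.
apply: (proj2 (@cvgrPdist_lt R R _ (nbhs x) _ g (g x))) => e e0.
have /cvgrPdist_lt H := cg x.
have /H : 0 < e%:C :> R[i] by rewrite ltcR.
apply: (@filterS _ (nbhs x)) => y /=.
by rewrite -rmorphB/= normc_def/= expr0n addr0 sqrtr_sqr ltcR.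
Qed.

End Periodic.

(** * Fejér means *)

Section Dotv.
Context {R : realType}.

Lemma dotvDl d (u v w : 'cV[R]_d) : dotv (u + v) w = dotv u w + dotv v w.
Proof. by rewrite /dotv -big_split; apply: eq_bigr => j _; rewrite mxE mulrDl. Qed.
Lemma dotvDr d (u v w : 'cV[R]_d) : dotv w (u + v) = dotv w u + dotv w v.
Proof. by rewrite /dotv -big_split; apply: eq_bigr => j _; rewrite mxE mulrDr. Qed.
Lemma dotvNr d (u v : 'cV[R]_d) : dotv u (- v) = - dotv u v.
Proof. by rewrite /dotv -sumrN; apply: eq_bigr => j _; rewrite mxE mulrN. Qed.
Lemma dotvBr d (u v w : 'cV[R]_d) : dotv w (u - v) = dotv w u - dotv w v.
Proof. by rewrite dotvDr dotvNr. Qed.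
Lemma dotvNl d (u v : 'cV[R]_d) : dotv (- u) v = - dotv u v.
Proof. by rewrite /dotv -sumrN; apply: eq_bigr => j _; rewrite mxE mulNr. Qed.
Lemma dotv_delta d (j : 'I_d) (v : 'cV[R]_d) : dotv (delta_mx j 0) v = v j 0.
Proof.
rewrite /dotv (bigD1 j)//= big1 ?addr0; first by rewrite mxE !eqxx mul1r.
by move=> i ij; rewrite mxE (negbTE ij) mul0r.
Qed.

End Dotv.

Section ComplexIntegral.
Context {R : realType}.

Definition cbuc d (f : 'cV[R]_d -> R[i]) :=
  buc (fun x => complex.Re (f x)) /\ buc (fun x => complex.Im (f x)).

Lemma cbuc_cst d (c : R[i]) : cbuc (fun _ : 'cV[R]_d => c).
Proof. by split; exact: buc_cst. Qed.

Lemma cbucM d (f g : 'cV[R]_d -> R[i]) :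
  cbuc f -> cbuc g -> cbuc (fun x => f x * g x).
Proof.
move=> [f1 f2] [g1 g2]; split.
  rewrite (_ : (fun x => _) = fun x => complex.Re (f x) * complex.Re (g x) +
     - (complex.Im (f x) * complex.Im (g x))).
    by apply: bucD; [exact: bucM|apply: bucN; exact: bucM].
  apply/funext => x. exact: cReM.
rewrite (_ : (fun x => _) = fun x => complex.Re (f x) * complex.Im (g x) +
     complex.Im (f x) * complex.Re (g x)).
  by apply: bucD; exact: bucM.
by apply/funext => x; exact: cImM.
Qed.

Lemma cbuc_sum d (I : finType) (F : I -> 'cV[R]_d -> R[i]) :
  (forall i, cbuc (F i)) -> cbuc (fun x => \sum_i F i x).
Proof.
move=> bF; split.
  rewrite (_ : (fun x => _) = fun x => \sum_i complex.Re (F i x)).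
    by apply: buc_sum => i; exact: (bF i).1.
  by apply/funext => x; exact: cRe_sum.
rewrite (_ : (fun x => _) = fun x => \sum_i complex.Im (F i x)).
  by apply: buc_sum => i; exact: (bF i).2.
by apply/funext => x; exact: cIm_sum.
Qed.

Lemma cbuc_expi d (f : 'cV[R]_d -> R) : unif_cont f -> cbuc (fun x => expi (f x)).
Proof. by move=> uf; split; [exact: buc_cos|exact: buc_sin]. Qed.

Lemma torus_integralZ d c (f : 'cV[R]_d -> R[i]) : cbuc f ->
  torus_integral (fun t => c * f t) = c * torus_integral f.
Proof.
move=> [f1 f2]; apply: complexP; rewrite ?cReM ?cImM [LHS]/=.
  rewrite (_ : (fun t => _) = fun t =>
    complex.Re c * complex.Re (f t) + (- complex.Im c) * complex.Im (f t)).
    by rewrite torus_Rintegral_lin ?torus_RintegralZ// ?mulNr//; exact: bucZ.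
  by apply/funext => t; rewrite cReM mulNr.
rewrite (_ : (fun t => _) = fun t =>
  complex.Re c * complex.Im (f t) + complex.Im c * complex.Re (f t)).
  by rewrite torus_Rintegral_lin ?torus_RintegralZ//; exact: bucZ.
by apply/funext => t; rewrite cImM.
Qed.

Lemma torus_integral_sum d (I : finType) (F : I -> 'cV[R]_d -> R[i]) :
  (forall i, cbuc (F i)) ->
  torus_integral (fun t => \sum_i F i t) = \sum_i torus_integral (F i).
Proof.
move=> bF; apply: complexP; rewrite ?cRe_sum ?cIm_sum [LHS]/=.
  rewrite (_ : (fun t => _) = fun t => \sum_i complex.Re (F i t)).
    by rewrite torus_Rintegral_sum// => i; exact: (bF i).1.
  by apply/funext => t; rewrite cRe_sum.
rewrite (_ : (fun t => _) = fun t => \sum_i complex.Im (F i t)).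
  by rewrite torus_Rintegral_sum// => i; exact: (bF i).2.
by apply/funext => t; rewrite cIm_sum.
Qed.

End ComplexIntegral.

Section Fejer.
Context {R : realType}.

Definition freq d N (p : {ffun 'I_d -> 'I_N}) : 'cV[int]_d := \col_j (p j)%:Z.

(** Written through the Fourier coefficients of f, so that its pairing with a
    finitely supported measure is a finite sum over frequencies. *)
Definition fejer_sum d N (f : 'cV[R]_d -> R[i]) (z : 'cV[R]_d) : R[i] :=
  ((N%:R ^+ d)^-1)%:C * \sum_(p : {ffun 'I_d -> 'I_N}) \sum_(q : {ffun 'I_d -> 'I_N})
    fourier_coef f (freq p - freq q) *
    expi (dotv (map_mx intr (freq p - freq q)) z).

Definition fejer_kernel d N (u : 'cV[R]_d) : R :=
  (N%:R ^+ d)^-1 *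
  \sum_(p : {ffun 'I_d -> 'I_N}) \sum_(q : {ffun 'I_d -> 'I_N})
    cos (dotv (map_mx intr (freq p - freq q)) u).

(** Double sums over differences of frequencies are squared moduli; this gives
    the positivity of the Fejér kernel and, later, the Fourier coefficients of
    the tent measures. *)
Lemma sum_expi_diff (I : finType) (F : I -> R) :
  \sum_p \sum_q expi (F p - F q) = (normc (\sum_p expi (F p)) ^+ 2)%:C.
Proof.
rewrite -mulc_conj mulr_suml; apply: eq_bigr => p _.
rewrite rmorph_sum mulr_sumr; apply: eq_bigr => q _.
by rewrite expiD expiN.
Qed.

Lemma freq_dotvB d N (p q : {ffun 'I_d -> 'I_N}) (u : 'cV[R]_d) :
  dotv (map_mx intr (freq p - freq q)) u =
  dotv (map_mx intr (freq p)) u - dotv (map_mx intr (freq q)) u.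
Proof. by rewrite map_mxB dotvDl dotvNl. Qed.

Lemma sum_expi_freq d N (u : 'cV[R]_d) :
  \sum_(p : {ffun 'I_d -> 'I_N}) \sum_(q : {ffun 'I_d -> 'I_N})
    expi (dotv (map_mx intr (freq p - freq q)) u) =
  (normc (\sum_(p : {ffun 'I_d -> 'I_N}) expi (dotv (map_mx intr (freq p)) u)) ^+ 2)%:C.
Proof.
rewrite -sum_expi_diff; apply: eq_bigr => p _; apply: eq_bigr => q _.
by rewrite freq_dotvB.
Qed.

Lemma fejer_kernelE d N (u : 'cV[R]_d) : (fejer_kernel N u)%:C =
  ((N%:R ^+ d)^-1)%:C * \sum_(p : {ffun 'I_d -> 'I_N}) \sum_(q : {ffun 'I_d -> 'I_N})
    expi (dotv (map_mx intr (freq p - freq q)) u).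
Proof.
rewrite rmorphM sum_expi_freq; congr (_ * _); congr (_%:C).
rewrite -[RHS]/(complex.Re (_)%:C) -sum_expi_freq cRe_sum.
by apply: eq_bigr => p _; rewrite cRe_sum.
Qed.

Lemma sum_sin_freq d N (u : 'cV[R]_d) :
  \sum_(p : {ffun 'I_d -> 'I_N}) \sum_(q : {ffun 'I_d -> 'I_N})
    sin (dotv (map_mx intr (freq p - freq q)) u) = 0.
Proof.
have /(congr1 (@complex.Im R)) := sum_expi_freq N u.
rewrite cIm_sum => E; apply: etrans E.
by apply: eq_bigr => p _; rewrite cIm_sum.
Qed.

Lemma fejer_kernel_ge0 d N (u : 'cV[R]_d) : 0 <= fejer_kernel N u.
Proof.
rewrite -[fejer_kernel N u]/(complex.Re (fejer_kernel N u)%:C) fejer_kernelE.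
by rewrite sum_expi_freq -rmorphM /= mulr_ge0 ?sqr_ge0// invr_ge0 exprn_ge0.
Qed.

Lemma unif_cont_dotvB d (u z : 'cV[R]_d) : unif_cont (fun t => dotv u (z - t)).
Proof.
rewrite (_ : (fun t => _) = fun t => dotv u z + dotv (- u) t).
  by apply: unif_contD; [exact: unif_cont_cst|exact: unif_cont_dotv].
by apply/funext => t; rewrite dotvBr dotvNl.
Qed.

Lemma buc_fejer_kernel d N (z : 'cV[R]_d) : buc (fun t => fejer_kernel N (z - t)).
Proof.
apply: bucZ; apply: buc_sum => p; apply: buc_sum => q.
by apply: buc_cos; exact: unif_cont_dotvB.
Qed.

(** By linearity of the integral; in this convolution form the positivity of the
    kernel can be used. *)
Lemma fejer_sumE d N (f : 'cV[R]_d -> R[i]) z : cbuc f ->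
  fejer_sum N f z = (((2 * pi) ^+ d)^-1)%:C *
    torus_integral (fun t => f t * (fejer_kernel N (z - t))%:C).
Proof.
move=> bf.
have be (n : 'cV[int]_d) : cbuc (fun t : 'cV[R]_d => expi (- dotv (map_mx intr n) t)).
  apply: cbuc_expi; rewrite (_ : (fun x => _) = dotv (- map_mx intr n)).
    exact: unif_cont_dotv.
  by apply/funext => t; rewrite dotvNl.
have bfe (n : 'cV[int]_d) :
    cbuc (fun t => f t * expi (- dotv (map_mx intr n) t)) by exact: cbucM.
transitivity (((N%:R ^+ d)^-1)%:C * ((((2 * pi) ^+ d)^-1)%:C *
    torus_integral (fun t => \sum_(p : {ffun 'I_d -> 'I_N})
      \sum_(q : {ffun 'I_d -> 'I_N}) expi (dotv (map_mx intr (freq p - freq q)) z) *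
      (f t * expi (- dotv (map_mx intr (freq p - freq q)) t))))).
  rewrite torus_integral_sum; last first.
    move=> p; apply: cbuc_sum => q; apply: cbucM => //; exact: cbuc_cst.
  rewrite /fejer_sum; congr (_ * _); rewrite mulr_sumr; apply: eq_bigr => p _.
  rewrite torus_integral_sum; last first.
    by move=> q; apply: cbucM => //; exact: cbuc_cst.
  rewrite mulr_sumr; apply: eq_bigr => q _.
  by rewrite torus_integralZ// /fourier_coef mulrA mulrC; ring.
rewrite mulrCA; congr (_ * _); rewrite -torus_integralZ; last first.
  apply: cbuc_sum => p; apply: cbuc_sum => q; apply: cbucM => //.
  exact: cbuc_cst.
congr torus_integral; apply/funext => t; rewrite fejer_kernelE mulrCA.
congr (_ * _); rewrite mulr_sumr; apply: eq_bigr => p _.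
rewrite mulr_sumr; apply: eq_bigr => q _.
by rewrite mulrCA -expiD dotvBr.
Qed.

Lemma torus_Rintegral_cosB d (n : 'cV[int]_d) (z : 'cV[R]_d) :
  torus_Rintegral (fun t => cos (dotv (map_mx intr n) (z - t))) =
  if n == 0 then (2 * pi) ^+ d else 0.
Proof.
have bc : buc (fun x : 'cV[R]_d => cos (dotv (map_mx intr n) x)).
  by apply: buc_cos; exact: unif_cont_dotv.
have bs : buc (fun x : 'cV[R]_d => sin (dotv (map_mx intr n) x)).
  by apply: buc_sin; exact: unif_cont_dotv.
under eq_fun do rewrite dotvBr cosB.
rewrite torus_Rintegral_lin//; last exact: bucZ.
rewrite torus_RintegralZ// !torus_Rintegral_char mulr0 addr0.
case: eqP => [->|_]; last by rewrite mulr0.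
by rewrite map_mx0 /dotv big1 ?cos0 ?mul1r// => j _; rewrite mxE mul0r.
Qed.

Lemma freq_inj d N : injective (@freq d N).
Proof.
move=> p q /colP pq; apply/ffunP => j; have := pq j; rewrite !mxE.
by move=> /(congr1 absz)/= /val_inj.
Qed.

Lemma fejer_kernel_mass d N (z : 'cV[R]_d) :
  torus_Rintegral (fun t => fejer_kernel N.+1 (z - t)) = (2 * pi) ^+ d.
Proof.
have bc n : buc (fun t => cos (dotv (map_mx intr n) (z - t))).
  by apply: buc_cos; exact: unif_cont_dotvB.
rewrite torus_RintegralZ; last by apply: buc_sum => p; apply: buc_sum => q.
rewrite torus_Rintegral_sum; last by move=> p; apply: buc_sum => q.
rewrite (eq_bigr (fun=> (2 * pi) ^+ d)); last first.
  move=> p _; rewrite torus_Rintegral_sum// (bigD1 p)//= big1 ?addr0.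
    by rewrite torus_Rintegral_cosB subrr eqxx.
  move=> q qp; rewrite torus_Rintegral_cosB subr_eq0 (inj_eq (@freq_inj _ _)).
  by rewrite eq_sym (negbTE qp).
rewrite sumr_const card_ffun !card_ord -[X in _ * X]mulr_natr natrX.
by rewrite mulrCA mulVf ?mulr1// expf_neq0.
Qed.

(** The number of frequencies of the box that stay in it when the j-th
    coordinate is increased by one. *)
Lemma card_shiftable d N (j : 'I_d) :
  (\sum_(p : {ffun 'I_d -> 'I_N.+1}) (p j < N) = N * N.+1 ^ d.-1)%N.
Proof.
(* The condition is a product of one-coordinate conditions. *)
pose F (i : 'I_d) (x : 'I_N.+1) : nat := if i == j then (x < N : nat)%N else 1%N.
transitivity (\sum_(p : {ffun 'I_d -> 'I_N.+1}) \prod_i F i (p i))%N.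
  apply: eq_bigr => p _; rewrite (bigD1 j)//= big1 ?muln1; first by rewrite /F eqxx.
  by move=> i ij; rewrite /F (negbTE ij).
rewrite -(bigA_distr_bigA F) (bigD1 j)//=; congr (_ * _)%N.
  rewrite /F eqxx big_ord_recr /= ltnn addn0.
  rewrite (eq_bigr (fun=> 1%N)); last by move=> i _; rewrite ltn_ord.
  by rewrite sum1_card card_ord.
rewrite (eq_bigr (fun=> N.+1)); last first.
  by move=> i ij; rewrite /F (negbTE ij) sum1_card card_ord.
by rewrite prod_nat_const cardC1 card_ord.
Qed.

(** Multiplication by cos u_j shifts the frequencies p - q by a unit vector,
    so the mean of K cos u_j is the proportion of the points p of the box that
    stay in it after that shift, namely N / (N + 1); the missing 1 / (N + 1) is
    the moment. *)
Lemma fejer_kernel_moment d N (z : 'cV[R]_d) (j : 'I_d) :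
  torus_Rintegral (fun t => fejer_kernel N.+1 (z - t) * (1 - cos (z j 0 - t j 0)))
  <= (2 * pi) ^+ d / N.+1%:R.
Proof.
have bc n : buc (fun t => cos (dotv (map_mx intr n) (z - t))).
  by apply: buc_cos; exact: unif_cont_dotvB.
have pi0 : 0 < (2 * pi : R) ^+ d by rewrite exprn_gt0// mulr_gt0// pi_gt0.
have N0 : 0 < N.+1%:R :> R by [].
pose e : 'cV[int]_d := delta_mx j 0.
have eE n (u : 'cV[R]_d) : dotv (map_mx intr (n + e)) u = dotv (map_mx intr n) u + u j 0.
  by rewrite map_mxD dotvDl map_delta_mx dotv_delta.
have kE (t : 'cV[R]_d) : fejer_kernel N.+1 (z - t) * (1 - cos (z j 0 - t j 0)) =
    fejer_kernel N.+1 (z - t) + (- (N.+1%:R ^+ d)^-1) *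
    \sum_(p : {ffun 'I_d -> 'I_N.+1}) \sum_(q : {ffun 'I_d -> 'I_N.+1})
      cos (dotv (map_mx intr (freq p - freq q + e)) (z - t)).
  rewrite mulrBr mulr1; congr (_ + _); rewrite mulNr -mulrA; congr (- (_ * _)).
  (* The sines sum to 0, so the product of cosines may be completed to cos (A + B). *)
  rewrite -[LHS]subr0 -[X in _ - X](mul0r (sin (z j 0 - t j 0))).
  rewrite -[X in X * sin _](sum_sin_freq N.+1 (z - t)) !mulr_suml -sumrB; apply: eq_bigr => p _.
  rewrite !mulr_suml -sumrB; apply: eq_bigr => q _.
  by rewrite eE [RHS]cosD !mxE.
under eq_fun do rewrite kE.
have bS : buc (fun t => \sum_(p : {ffun 'I_d -> 'I_N.+1})
    \sum_(q : {ffun 'I_d -> 'I_N.+1})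
      cos (dotv (map_mx intr (freq p - freq q + e)) (z - t))).
  by apply: buc_sum => p; apply: buc_sum => q.
rewrite torus_Rintegral_lin//; last exact: buc_fejer_kernel.
rewrite fejer_kernel_mass mulNr.
suff H : N%:R * N.+1%:R ^+ d.-1 * (2 * pi) ^+ d <=
    torus_Rintegral (fun t => \sum_(p : {ffun 'I_d -> 'I_N.+1})
    \sum_(q : {ffun 'I_d -> 'I_N.+1})
      cos (dotv (map_mx intr (freq p - freq q + e)) (z - t))).
  have dE : d = d.-1.+1 by rewrite (ltn_predK (ltn_ord j)).
  have Q0 : 0 < (N.+1%:R ^+ d)^-1 :> R by rewrite invr_gt0 exprn_gt0.
  apply: le_trans (_ : (2 * pi) ^+ d -
    (N.+1%:R ^+ d)^-1 * (N%:R * N.+1%:R ^+ d.-1 * (2 * pi) ^+ d) <= _).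
    by rewrite lerD2l lerN2 ler_pM2l.
  have -> : (N.+1%:R ^+ d)^-1 * (N%:R * N.+1%:R ^+ d.-1 * (2 * pi) ^+ d) =
      N%:R / N.+1%:R * (2 * pi) ^+ d :> R.
    rewrite {1}dE exprS invfM; field.
    by rewrite expf_neq0 ?gt_eqF.
  rewrite le_eqVlt; apply/orP; left; apply/eqP.
  field.
  by rewrite addrC natr1 gt_eqF.
rewrite torus_Rintegral_sum; last by move=> p; exact: buc_sum.
rewrite -natrX -natrM -(card_shiftable N j) natr_sum mulr_suml.
apply: ler_sum => p _; rewrite torus_Rintegral_sum//.
have nonneg q : 0 <= torus_Rintegral
   (fun t => cos (dotv (map_mx intr (freq p - freq q + e)) (z - t))).
  by rewrite torus_Rintegral_cosB; case: ifP => // _; exact: ltW.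
case: ltnP => pj /=; last by rewrite mul0r sumr_ge0.
pose q : {ffun 'I_d -> 'I_N.+1} := [ffun i => if i == j then inord (p j).+1 else p i].
rewrite (bigD1 q)//= mul1r -[leLHS]addr0 lerD ?sumr_ge0//.
rewrite torus_Rintegral_cosB ifT//; apply/eqP/colP => i.
rewrite !mxE ffunE eqxx andbT; case: eqP => [->|_]; last by rewrite addr0 subrr.
by rewrite inordK ?ltnS//= -[(p j).+1]addn1 PoszD; ring.
Qed.

(** A periodic uniformly continuous u satisfies |u t - u z| <= e unless some
    coordinate of t - z is at distance more than r from the period lattice; then
    1 - cos is at least 1 - cos r there, and the bound of u takes over. *)
Lemma modulus_by_cos d (u : 'cV[R]_d -> R) : periodic2pi u -> buc u ->
  forall e : R, 0 < e -> exists2 C : R, 0 <= C & forall z t : 'cV[R]_d,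
    `|u t - u z| <= e + C * \sum_j (1 - cos (z j 0 - t j 0)).
Proof.
move=> pu [[M uM] uu] e e0; have pi0 := @pi_gt0 R.
have [r0 r00 r0P] := uu e e0.
pose r := Num.min r0 pi.
have rpi : r <= pi by rewrite /r ge_min lexx orbT.
have r_gt0 : 0 < r by rewrite lt_min r00.
have M0 : 0 <= M by exact: le_trans (normr_ge0 _) (uM 0).
have c0 : 0 < 1 - cos r.
  by rewrite subr_gt0 -(@cos0 R) ltr_cos// in_itv/= ?lexx ?(ltW r_gt0)// ltW.
have sum0 (z t : 'cV[R]_d) : 0 <= \sum_j (1 - cos (z j 0 - t j 0)).
  by apply: sumr_ge0 => j _; rewrite subr_ge0 cos_le1.
have C0 : 0 <= 2 * M / (1 - cos r) by rewrite divr_ge0 ?mulr_ge0// ltW.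
exists (2 * M / (1 - cos r)) => // z t.
have [n nP] := reduce_2piV (t - z).
have := pselect (forall j, `|(t - z + (2 * pi) *: map_mx intr n) j 0| <= r).
move=> [small|big].
  rewrite -(periodic2piZ n t pu).
  apply: (@le_trans _ _ e); last by rewrite lerDl mulr_ge0.
  apply: r0P => j; have := small j; rewrite !mxE.
  rewrite addrAC => /le_trans; apply; by rewrite /r ge_min lexx.
have {big}[j jP] : exists j, r < `|(t - z + (2 * pi) *: map_mx intr n) j 0|.
  apply: contrapT => H; apply: big => j; rewrite leNgt; apply/negP => jP.
  by apply: H; exists j.
have cj : cos (z j 0 - t j 0) <= cos r.
  rewrite -cosN opprB -(trig_periodZ (n j 0) _).1 -cos_norm.
  have := nP j; move: jP; rewrite !mxE => rj jpi.
  by rewrite ltW// ltr_cos// in_itv/= ?normr_ge0 ?(ltW r_gt0).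
have H1 : 1 - cos r <= \sum_j (1 - cos (z j 0 - t j 0)).
  rewrite (bigD1 j)//=; rewrite -[leLHS]addr0 lerD//; first by lra.
  by apply: sumr_ge0 => i _; rewrite subr_ge0 cos_le1.
have H2 : 2 * M <= 2 * M / (1 - cos r) * \sum_j (1 - cos (z j 0 - t j 0)).
  apply: le_trans (ler_wpM2l C0 H1).
  by rewrite divfK ?gt_eqF.
apply: le_trans (_ : 2 * M <= _); last by apply: le_trans H2 _; lra.
apply: le_trans (ler_normB _ _) _; have := uM t; have := uM z; lra.
Qed.

Lemma fejer_real_approx d (u : 'cV[R]_d -> R) : periodic2pi u -> buc u ->
  forall e : R, 0 < e -> exists2 C : R, 0 <= C & forall N (z : 'cV[R]_d),
    `|((2 * pi) ^+ d)^-1 * torus_Rintegral (fun t => u t * fejer_kernel N.+1 (z - t))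
      - u z| <= e + C / N.+1%:R.
Proof.
move=> pu bu e e0; have [C C0 CP] := modulus_by_cos pu bu e0.
exists (C * d%:R) => [|N z]; first by rewrite mulr_ge0.
have p0 : 0 < (2 * pi : R) ^+ d by rewrite exprn_gt0// mulr_gt0// pi_gt0.
have bk := buc_fejer_kernel N.+1 z.
have bcos (j : 'I_d) : buc (fun t : 'cV[R]_d => 1 - cos (z j 0 - t j 0)).
  apply: bucD; first exact: buc_cst.
  apply/bucN/buc_cos; apply: unif_contD; first exact: unif_cont_cst.
  by apply: (@unif_cont_lipschitz _ _ _ -%R) (@unif_cont_coord _ _ j) => s t;
     rewrite -opprD normrN.
have -> : ((2 * pi) ^+ d)^-1 * torus_Rintegral (fun t => u t * fejer_kernel N.+1 (z - t))
    - u z = ((2 * pi) ^+ d)^-1 *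
      torus_Rintegral (fun t =>
        u t * fejer_kernel N.+1 (z - t) + (- u z) * fejer_kernel N.+1 (z - t)).
  rewrite torus_Rintegral_lin//; last exact: bucM.
  by rewrite fejer_kernel_mass; field; rewrite gt_eqF.
rewrite normrM ger0_norm ?invr_ge0 ?(ltW p0)// mulrC ler_pdivrMr//.
apply: le_trans (_ : torus_Rintegral (fun t => e * fejer_kernel N.+1 (z - t) +
    C * \sum_j (fejer_kernel N.+1 (z - t) * (1 - cos (z j 0 - t j 0)))) <= _).
  apply: normr_torus_Rintegral_le.
  - by apply: bucD; [exact: bucM|exact: bucZ].
  - apply: bucD; first exact: bucZ.
    by apply: bucZ; apply: buc_sum => j; exact: bucM.
  - move=> t; rewrite -mulrDl normrM [X in _ * X]ger0_norm ?fejer_kernel_ge0//.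
    rewrite -mulr_sumr [leRHS](_ : _ =
      (e + C * \sum_j (1 - cos (z j 0 - t j 0))) * fejer_kernel N.+1 (z - t));
      last by ring.
    by apply: ler_wpM2r; rewrite ?fejer_kernel_ge0.
rewrite torus_Rintegral_lin; last 2 first.
- exact: bucZ.
- by apply: buc_sum => j; exact: bucM.
rewrite torus_RintegralZ// fejer_kernel_mass [leRHS]mulrDl lerD2l.
rewrite torus_Rintegral_sum; last by move=> j; exact: bucM.
rewrite -mulrA -mulrA ler_wpM2l//.
apply: le_trans (ler_sum _ (fun j _ => fejer_kernel_moment N z j)) _.
by rewrite sumr_const card_ord -[leLHS]mulr_natl mulrA mulrAC.
Qed.

Lemma fejer_approx d (f : 'cV[R]_d -> R[i]) : periodic2pi f -> cbuc f ->
  forall e : R, 0 < e -> exists N, forall z, normc (fejer_sum N.+1 f z - f z) <= e.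
Proof.
move=> pf bf e e0.
have e40 : 0 < e / 4 by lra.
have p1 : periodic2pi (fun x => complex.Re (f x)) by move=> x j; rewrite pf.
have p2 : periodic2pi (fun x => complex.Im (f x)) by move=> x j; rewrite pf.
have [C1 C10 C1P] := fejer_real_approx p1 bf.1 e40.
have [C2 C20 C2P] := fejer_real_approx p2 bf.2 e40.
exists (Num.truncn ((C1 + C2) / (e / 2))) => z; set N := Num.truncn _.
have NP : (C1 + C2) / N.+1%:R <= e / 2.
  rewrite ler_pdivrMr// -ler_pdivrMl; last by lra.
  by rewrite mulrC ltW// truncnS_gt.
apply: le_trans (normc_le_ReIm _) _; rewrite fejer_sumE// cReB cImB cReM cImM.
rewrite /= !mul0r subr0 addr0.
have E1 : (fun t => complex.Re (f t * (fejer_kernel N.+1 (z - t))%:C)) =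
   (fun t => complex.Re (f t) * fejer_kernel N.+1 (z - t)).
  by apply/funext => t; rewrite cReM /= mulr0 subr0.
have E2 : (fun t => complex.Im (f t * (fejer_kernel N.+1 (z - t))%:C)) =
   (fun t => complex.Im (f t) * fejer_kernel N.+1 (z - t)).
  by apply/funext => t; rewrite cImM /= mulr0 add0r.
rewrite E1 E2; move: (C1P N z) (C2P N z) NP; rewrite (mulrDl C1 C2).
move: (C1 / _) (C2 / _) => x1 x2; lra.
Qed.

End Fejer.

(** * Duality with finitely supported measures *)

Section Duality.
Context {R : realType}.

Lemma A_norm_ge_sum d (f : 'cV[R]_d -> R[i]) (T : finType) (n : T -> 'cV[int]_d) :
  injective n -> ((\sum_t normc (fourier_coef f (n t)))%:E <= A_norm f)%E.
Proof.
move=> n_inj; apply: esum_ge; exists [set` map n (enum T)].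
  by split=> //; exact: finite_seq.
rewrite -fsbig_seq; last by rewrite map_inj_uniq ?enum_uniq.
by rewrite big_map -sumEFin big_enum.
Qed.

(** For fixed p the frequencies p - q are distinct, so each inner sum is a
    partial sum of the A-norm; there are (N + 1)^d values of p to average over. *)
Lemma A_norm_ge_fejer_coefs d N (f : 'cV[R]_d -> R[i]) :
  (((N.+1%:R ^+ d)^-1 * \sum_(p : {ffun 'I_d -> 'I_N.+1})
     \sum_(q : {ffun 'I_d -> 'I_N.+1})
       normc (fourier_coef f (freq p - freq q)))%:E <= A_norm f)%E.
Proof.
have H (p : {ffun 'I_d -> 'I_N.+1}) :
    ((\sum_(q : {ffun 'I_d -> 'I_N.+1})
        normc (fourier_coef f (freq p - freq q)))%:E <= A_norm f)%E.
  apply: (@A_norm_ge_sum _ _ _ (fun q => freq p - freq q)).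
  by move=> q q' /addrI/oppr_inj/freq_inj.
case E : (A_norm f) => [A| |]; last 2 first.
- by rewrite leey.
- by have := H [ffun=> ord0]; rewrite E.
rewrite lee_fin mulrC ler_pdivrMr ?exprn_gt0//.
apply: le_trans (_ : \sum_(p : {ffun 'I_d -> 'I_N.+1}) A <= _).
  by apply: ler_sum => p _; have := H p; rewrite E lee_fin.
by rewrite sumr_const card_ffun !card_ord -[leLHS]mulr_natr natrX.
Qed.

(** After an exchange of sums each coefficient of f is multiplied by the
    coefficient of the measure at the same frequency; D bounds the latter, and the
    former add up to at most the A-norm. *)
Lemma fejer_duality d N (f : 'cV[R]_d -> R[i]) (I : finType)
    (w : I -> R[i]) (z : I -> 'cV[R]_d) (D : R) : 0 <= D ->
  (forall p q : {ffun 'I_d -> 'I_N.+1}, normc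
     (\sum_i w i * expi (dotv (map_mx intr (freq p - freq q)) (z i))) <= D) ->
  ((normc (\sum_i w i * fejer_sum N.+1 f (z i)))%:E <= D%:E * A_norm f)%E.
Proof.
move=> D0 wD.
apply: le_trans (lee_wpmul2l _ (A_norm_ge_fejer_coefs N f)); last by rewrite lee_fin.
rewrite -EFinM lee_fin.
have -> : \sum_i w i * fejer_sum N.+1 f (z i) = ((N.+1%:R ^+ d)^-1)%:C *
    \sum_(p : {ffun 'I_d -> 'I_N.+1}) \sum_(q : {ffun 'I_d -> 'I_N.+1})
      fourier_coef f (freq p - freq q) *
      \sum_i w i * expi (dotv (map_mx intr (freq p - freq q)) (z i)).
  under eq_bigr do rewrite /fejer_sum mulrCA.
  rewrite -mulr_sumr; congr (_ * _).
  under eq_bigr do rewrite mulr_sumr.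
  rewrite exchange_big; apply: eq_bigr => p _ /=.
  under eq_bigr do rewrite mulr_sumr.
  rewrite exchange_big; apply: eq_bigr => q _ /=.
  by rewrite mulr_sumr; apply: eq_bigr => i _; rewrite mulrCA.
have Q0 : 0 <= (N.+1%:R ^+ d)^-1 :> R by rewrite invr_ge0 exprn_ge0.
rewrite Normc.normcM normc_real ger0_norm// mulrCA ler_wpM2l//.
apply: le_trans (normc_sum _) _; rewrite mulr_sumr; apply: ler_sum => p _.
apply: le_trans (normc_sum _) _; rewrite mulr_sumr; apply: ler_sum => q _.
by rewrite Normc.normcM mulrC ler_wpM2r// normc_ge0.
Qed.

End Duality.

(** * Dirichlet sums over a grid *)

Section Lattice.
Context {R : realType}.

(** Telescoping majorant: x / (1 + |x|) increases from -1 to 1 and its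
    increments over unit steps dominate 1 / (1 + x^2) up to the factor 4. *)
Lemma inv_one_sqr_le (x : R) : 0 <= x \/ x <= - 1 ->
  (1 + x ^+ 2)^-1 <= 4 * ((x + 1) / (1 + `|x + 1|) - x / (1 + `|x|)).
Proof.
have x2 : 0 < 1 + x ^+ 2 by rewrite ltr_pwDl// sqr_ge0.
case=> x0.
  rewrite !ger0_norm//; last by lra.
  have -> : 4 * ((x + 1) / (1 + (x + 1)) - x / (1 + x)) = 4 / ((1 + x) * (x + 2)).
    by field; apply/andP; split; apply: lt0r_neq0; lra.
  rewrite ler_pdivlMr; last by apply: mulr_gt0; lra.
  by rewrite mulrC ler_pdivrMr//; nra.
rewrite ler0_norm; last by lra.
rewrite ler0_norm; last by lra.
move: x0 x2; rewrite -[x]opprK; move: (- x) => y y1 y2.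
have -> : 4 * ((- y + 1) / (1 - (- y + 1)) - - y / (1 - - y)) = 4 / (y * (1 + y)).
  by field; apply/andP; split; apply: lt0r_neq0; lra.
rewrite ler_pdivlMr; last by apply: mulr_gt0; lra.
by rewrite mulrC ler_pdivrMr//; nra.
Qed.

Lemma sum_inv_one_sqr_le n (E : int) :
  \sum_(r < n) (1 + (E - r%:Z)%:~R ^+ 2)^-1 <= 8 :> R.
Proof.
pose H (e : int) : R := e%:~R / (1 + `|e%:~R|).
have HB e : `|H e| <= 1.
  rewrite normrM normfV [X in _ / X]ger0_norm ?addr_ge0// ler_pdivrMr ?ltr_pwDl//.
  by rewrite mul1r lerDr.
have step (x : int) : (1 + x%:~R ^+ 2)^-1 <= 4 * (H (x + 1) - H x).
  rewrite /H rmorphD/=; apply: inv_one_sqr_le.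
  have [h|h] := leP 0 x; [left|right]; first by rewrite ler0z.
  by rewrite -(mulrN1z (1 : R)) ler_int; lia.
apply: le_trans (_ : 4 * (H (n%:Z - E) - H (- E)) <= _); last first.
  have := HB (n%:Z - E); have := HB (- E); rewrite !ler_norml; lra.
elim: n => [|n IH]; first by rewrite big_ord0 sub0r subrr mulr0.
rewrite big_ord_recr /= -[in (_ ^+ 2)]opprB rmorphN sqrrN.
have := step (n%:Z - E); have -> : n%:Z - E + 1 = n.+1%:Z - E by lia.
by move: IH; lra.
Qed.

Lemma dirichlet_le M (t : R) : normc (\sum_(x < M) expi (t * x%:R)) <= M%:R.
Proof.
apply: le_trans (normc_sum _) _.
by under eq_bigr do rewrite normc_expi; rewrite sumr_const card_ord.
Qed.

(** Summing the geometric series: the modulus of 1 - e^{it} is at least |t| / 2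
    for small t, and that of 1 - e^{iMt} is at most 2. *)
Lemma dirichlet_decay M (t : R) : `|t| <= 2^-1 ->
  normc (\sum_(x < M) expi (t * x%:R)) ^+ 2 * t ^+ 2 <= 16.
Proof.
move=> /one_sub_expi_ge t2; set S := \sum_(x < M) _.
have S0 := normc_ge0 S.
have H : normc (1 - expi t) * normc S <= 2.
  have -> : S = \sum_(x < M) expi t ^+ x by apply: eq_bigr => x _; exact: expiMn.
  rewrite -Normc.normcM -opprB mulNr -subrX1 opprB -expiMn.
  apply: le_trans (normc_triangle _ _) _.
  by rewrite normcN normc_expi Normc.normc1.
have H2 : normc S * `|t| <= 4.
  have : `|t| / 2 * normc S <= 2 by apply: le_trans H; exact: ler_wpM2r.
  by move: (normc S) `|t| => u v; lra.
rewrite -[t ^+ 2]real_normK ?num_real// -exprMn -[leRHS](_ : 4 ^+ 2 = _); last by ring.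
by rewrite lerXn2r ?nnegrE ?mulr_ge0.
Qed.

End Lattice.

Section Cells.
Context {R : realType}.

(** The trivial bound M + 1 and the decay combine into one bound that is stated
    at e, a point near S xi, so that e can be an integer. *)
Lemma dirichlet_factor (S M : nat) (delta xi e : R) : 0 < delta ->
  `|S%:R * xi - e| <= 1 -> `|xi * (delta / M.+1%:R)| <= 2^-1 ->
  normc (\sum_(x < M.+1) expi (xi * (delta / M.+1%:R) * x%:R)) ^+ 2 <=
  M.+1%:R ^+ 2 * (3 + 32 * S%:R ^+ 2 / delta ^+ 2) * (1 + e ^+ 2)^-1.
Proof.
move=> d0 Se small.
have := dirichlet_decay M.+1 small; have := dirichlet_le M.+1 (xi * (delta / M.+1%:R)).
have := normc_ge0 (\sum_(x < M.+1) expi (xi * (delta / M.+1%:R) * x%:R)).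
move: (normc _) => D D0 DM DD.
have m0 : 0 < M.+1%:R :> R by [].
move: (M.+1%:R) m0 DM DD => m m0 DM DD.
have e2 : 0 < 1 + e ^+ 2 by rewrite ltr_pwDl// sqr_ge0.
rewrite ler_pdivlMr//.
have De : D ^+ 2 * xi ^+ 2 <= 16 * m ^+ 2 / delta ^+ 2.
  rewrite ler_pdivlMr ?exprn_gt0// -ler_pdivrMr ?exprn_gt0//.
  apply: le_trans DD; rewrite le_eqVlt; apply/orP; left; apply/eqP.
  by field; rewrite gt_eqF.
have D2 : D ^+ 2 <= m ^+ 2 by rewrite lerXn2r ?nnegrE// ltW.
have ee : 1 + e ^+ 2 <= 3 + 2 * (S%:R ^+ 2 * xi ^+ 2).
  move: Se; rewrite -exprMn; move: (S%:R * xi) => y; rewrite ler_norml => /andP[h1 h2].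
  by have := sqr_ge0 (2 * y - e); have : (y - e) ^+ 2 <= 1; nra.
apply: le_trans (ler_wpM2l (sqr_ge0 D) ee) _.
have := ler_wpM2l (sqr_ge0 (S%:R : R)) De.
move: (S%:R ^+ 2 : R) => s.
have -> : m ^+ 2 * (3 + 32 * s / delta ^+ 2) =
  3 * m ^+ 2 + 2 * (s * (16 * m ^+ 2 / delta ^+ 2)).
  by field; rewrite gt_eqF.
move: (16 * m ^+ 2 / delta ^+ 2) => y; nra.
Qed.

Lemma dirichlet_prod m M (h : R) (u : 'cV[R]_m) :
  \sum_(p : {ffun 'I_m -> 'I_M}) expi (dotv u (h *: map_mx intr (freq p))) =
  \prod_j \sum_(x < M) expi (u j 0 * h * x%:R).
Proof.
rewrite bigA_distr_bigA; apply: eq_bigr => p _; rewrite -expi_sum.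
by congr expi; apply: eq_bigr => j _; rewrite !mxE mulrA.
Qed.

(** The points v r lie in different cells of the grid of side 1 / S, and
    translation by the integer vector l permutes the cells.  After bounding each
    term by a product of functions of the coordinates of the cell, the sum over
    the cells in A is at most the sum over the whole box, which factors into m
    sums of 1 / (1 + e^2). *)
Lemma dirichlet_cells m (S L M : nat) (B : int) (delta : R)
    (A : {set {ffun 'I_m -> 'I_L}}) (v : {ffun 'I_m -> 'I_L} -> 'cV[R]_m)
    (l : 'cV[int]_m) : 0 < delta ->
  (forall r, r \in A -> forall j, Num.floor (S%:R * v r j 0) = (r j)%:Z - B) ->
  (forall r, r \in A -> forall j,
    `|((l j 0)%:~R - v r j 0) * (delta / M.+1%:R)| <= 2^-1) ->
  \sum_(r in A) normc (\sum_(p : {ffun 'I_m -> 'I_M.+1})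
    expi (dotv (map_mx intr l - v r) ((delta / M.+1%:R) *: map_mx intr (freq p)))) ^+ 2
  <= (8 * (3 + 32 * S%:R ^+ 2 / delta ^+ 2)) ^+ m * (M.+1%:R ^+ 2) ^+ m.
Proof.
move=> d0 floorE small; set K := 3 + _.
have K0 : 0 <= K.
  by apply: addr_ge0 => //; apply: divr_ge0; rewrite ?sqr_ge0//; apply: mulr_ge0; rewrite ?sqr_ge0.
(* S (l - v r) lies within 1 of the integer vector E - r. *)
pose E j : int := S%:Z * l j 0 + B.
pose G j (x : 'I_L) : R := M.+1%:R ^+ 2 * K * (1 + (E j - x%:Z)%:~R ^+ 2)^-1.
have G0 j x : 0 <= G j x.
  by rewrite mulr_ge0 ?invr_ge0 ?addr_ge0 ?sqr_ge0// mulr_ge0// sqr_ge0.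
apply: le_trans (_ : \sum_(r : {ffun 'I_m -> 'I_L}) \prod_j G j (r j) <= _).
  rewrite big_mkcond; apply: ler_sum => r _; case: ifP => [rA|_]; last exact: prodr_ge0.
  rewrite dirichlet_prod.
  have -> : normc (\prod_j \sum_(x < M.+1)
      expi ((map_mx intr l - v r) j 0 * (delta / M.+1%:R) * x%:R)) =
    \prod_j normc (\sum_(x < M.+1)
      expi ((map_mx intr l - v r) j 0 * (delta / M.+1%:R) * x%:R)).
    exact: (big_morph _ (@Normc.normcM R) (@Normc.normc1 R)).
  rewrite -prodrXl; apply: ler_prod => j _; rewrite sqr_ge0/= !mxE.
  apply: dirichlet_factor => //; last exact: small.
  have /andP[h1 h2] := floor_itv (S%:R * v r j 0).
  move: h1 h2; rewrite (floorE r rA j) /E.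
  rewrite !rmorphD !rmorphN !rmorphM /= mulrBr ler_norml !rmorph1.
  rewrite -!pmulrn; lra.
rewrite -(bigA_distr_bigA G) -exprMn.
rewrite -[X in _ ^+ X]card_ord -prodr_const; apply: ler_prod => j _.
rewrite sumr_ge0//= -mulr_sumr [leRHS](_ : _ = M.+1%:R ^+ 2 * K * 8); last by ring.
by rewrite ler_wpM2l ?sum_inv_one_sqr_le// mulr_ge0// sqr_ge0.
Qed.

End Cells.

(** * The phase and the grid of cells *)

Section Phase.
Context {R : realType}.

Lemma buc_usubmx k m (g : 'cV[R]_k -> R) :
  buc g -> buc (fun z : 'cV[R]_(k + m) => g (usubmx z)).
Proof.
move=> [[M gM] ug]; split; first by exists M.
move=> e e0; have [r r0 gr] := ug e e0; exists r => // x y xy; apply: gr => j.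
by rewrite !mxE.
Qed.

Lemma buc_dsubmx k m (g : 'cV[R]_m -> R) :
  buc g -> buc (fun z : 'cV[R]_(k + m) => g (dsubmx z)).
Proof.
move=> [[M gM] ug]; split; first by exists M.
move=> e e0; have [r r0 gr] := ug e e0; exists r => // x y xy; apply: gr => j.
by rewrite !mxE.
Qed.

Lemma of_class_A_buc p q (s : 'cV[R]_p -> 'cV[R]_q) : of_class_A s ->
  periodic2pi s /\ forall j, buc (fun x => s x j 0).
Proof.
move=> As; split; last by move=> j; case: (in_A_real_buc (As j)).
move=> x j; apply/colP => i; case: (in_A_real_buc (As i)) => ps _; exact: ps.
Qed.

Lemma cbuc_expi_phase k m (a : 'cV[R]_k -> 'cV[R]_m) (b : 'cV[R]_m -> 'cV[R]_m)
    (lambda : R) : of_class_A a -> of_class_A b ->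
  cbuc (fun z => expi (lambda * phase a b z)).
Proof.
move=> /of_class_A_buc[_ ba] /of_class_A_buc[_ bb].
apply: cbuc_expi; apply: (proj2 (bucZ _ _)); apply: buc_sum => j; apply: bucM.
  exact: (@buc_usubmx k m (fun x => a x j 0)).
exact: (@buc_dsubmx k m (fun x => b x j 0)).
Qed.

Lemma periodic_expi_phase k m (a : 'cV[R]_k -> 'cV[R]_m) (b : 'cV[R]_m -> 'cV[R]_m)
    (lambda : R) : of_class_A a -> of_class_A b ->
  periodic2pi (fun z => expi (lambda * phase a b z)).
Proof.
move=> /of_class_A_buc[pa _] /of_class_A_buc[pb _] z j; congr (expi (_ * _)).
rewrite /phase !linearD !linearZ /=; case: (split_ordP j) => i ->.
  have -> : usubmx (delta_mx (lshift m i) 0 : 'cV[R]_(k + m)) = delta_mx i 0.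
    by apply/colP => i'; rewrite !mxE eq_lshift.
  have -> : dsubmx (delta_mx (lshift m i) 0 : 'cV[R]_(k + m)) = 0.
    by apply/colP => i'; rewrite !mxE eq_rlshift.
  by rewrite pa scaler0 addr0.
have -> : usubmx (delta_mx (rshift k i) 0 : 'cV[R]_(k + m)) = 0.
  by apply/colP => i'; rewrite !mxE eq_lrshift.
have -> : dsubmx (delta_mx (rshift k i) 0 : 'cV[R]_(k + m)) = delta_mx i 0.
  by apply/colP => i'; rewrite !mxE eq_rshift.
by rewrite pb scaler0 addr0.
Qed.

Lemma dotvZl d (c : R) (u v : 'cV[R]_d) : dotv (c *: u) v = c * dotv u v.
Proof. by rewrite /dotv mulr_sumr; apply: eq_bigr => j _; rewrite mxE mulrA. Qed.

Lemma dotv_mulmx d (P : 'M[R]_d) (u v : 'cV[R]_d) :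
  dotv u (P *m v) = dotv (P^T *m u) v.
Proof.
have dE (x y : 'cV[R]_d) : dotv x y = (x^T *m y) 0 0.
  by rewrite mxE; apply: eq_bigr => j _; rewrite mxE.
by rewrite !dE trmx_mul trmxK mulmxA.
Qed.

Lemma dotv_col_mx k m (u1 v1 : 'cV[R]_k) (u2 v2 : 'cV[R]_m) :
  dotv (col_mx u1 u2) (col_mx v1 v2) = dotv u1 v1 + dotv u2 v2.
Proof.
rewrite /dotv big_split_ord /=; congr (_ + _); apply: eq_bigr => j _.
  by rewrite !col_mxEu.
by rewrite !col_mxEd.
Qed.

Lemma enorm_le_sum d (w : 'cV[R]_d) : enorm w <= \sum_j `|w j 0|.
Proof.
have s0 : 0 <= \sum_j `|w j 0| by exact: sumr_ge0.
rewrite -[leRHS]ger0_norm// -sqrtr_sqr ler_wsqrtr// expr2 mulr_suml.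
apply: ler_sum => j _; apply: le_trans (ler_norm _) _.
rewrite normrM ler_wpM2l// (bigD1 j)//= lerDl.
exact: sumr_ge0.
Qed.

Lemma enorm_mulmx_le d (Q : 'M[R]_d) (u : 'cV[R]_d) (t : R) :
  (forall j, `|u j 0| <= t) ->
  enorm (Q *m u) <= (\sum_i \sum_j `|Q i j|) * t.
Proof.
move=> ut; apply: le_trans (enorm_le_sum _) _; rewrite mulr_suml.
apply: ler_sum => i _; rewrite mxE mulr_suml.
apply: le_trans (ler_norm_sum _ _ _) _; apply: ler_sum => j _.
by rewrite normrM ler_wpM2l.
Qed.

(** A is the set of cells met by v, a cell being indexed by its integer
    coordinates shifted by B to make them nonnegative; X chooses a parameter of
    a point in each of these cells. *)
Lemma grid_cells (U : Type) m (v : U -> 'cV[R]_m) (x0 : U) (B : nat) :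
  (forall x j, `|v x j 0| <= B%:R) ->
  exists (A : {set {ffun 'I_m -> 'I_(B + B).+1}}) (X : {ffun 'I_m -> 'I_(B + B).+1} -> U),
    (forall r, r \in A -> forall j, Num.floor (v (X r) j 0) = (r j)%:Z - B%:Z) /\
    (forall x, exists2 r, r \in A &
       forall j, Num.floor (v x j 0) = Num.floor (v (X r) j 0)).
Proof.
move=> vB.
pose cell (r : {ffun 'I_m -> 'I_(B + B).+1}) x :=
  forall j, Num.floor (v x j 0) = (r j)%:Z - B%:Z.
have /choice[X XP] : forall r, exists x, (exists y, cell r y) -> cell r x.
  by move=> r; have [[y ry]|nr] := pselect (exists y, cell r y); [exists y|exists x0].
exists [set r | `[< exists y, cell r y >]]%SET, X; split=> [r|x].
  by rewrite inE => /asboolP/XP.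
pose r : {ffun 'I_m -> 'I_(B + B).+1} :=
  [ffun j => inord (absz (Num.floor (v x j 0) + B%:Z)%R)].
have rx : cell r x.
  move=> j; have := vB x j; rewrite ler_norml => /andP[h1 h2].
  have f1 : - B%:Z <= Num.floor (v x j 0) by rewrite floor_ge_int rmorphN.
  have f2 : Num.floor (v x j 0) < B%:Z + 1.
    by rewrite floor_lt_int rmorphD /= -pmulrn; lra.
  by rewrite ffunE inordK; lia.
have ex : exists y, cell r y by exists x.
exists r; first by rewrite inE; exact/asboolP.
by move=> j; rewrite rx (XP r ex).
Qed.

End Phase.

(** * The lower bound *)

Section LowerBound.
Context {R : realType}.

(** The measure is the sum of the point masses at the z i, each weighted by the
    conjugate of the value of the unimodular function there, so that its integral
    is the number of points; replacing the function by a Fejér mean within 1/2 of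
    it costs at most half of that. *)
Lemma A_norm_ge_points (d : nat) (f : 'cV[R]_d -> R) (I : finType) (z : I -> 'cV[R]_d)
  (D : R) N : 0 <= D ->
  (forall z, normc (fejer_sum N.+1 (fun z => expi (f z)) z - expi (f z)) <= 2^-1) ->
  (forall p q : {ffun 'I_d -> 'I_N.+1}, normc
     (\sum_i expi (dotv (map_mx intr (freq p - freq q)) (z i) - f (z i))) <= D) ->
  ((#|I|%:R / 2)%:E <= D%:E * A_norm (fun z => expi (f z)))%E.
Proof.
move=> D0 close sumD.
apply: le_trans (@fejer_duality _ _ N _ I (fun i => expi (- f (z i))) z D D0 _); last first.
  move=> p q; apply: le_trans (sumD p q); rewrite le_eqVlt; apply/orP; left; apply/eqP.
  by congr normc; apply: eq_bigr => i _; rewrite -expiD addrC.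
rewrite lee_fin; set g := fejer_sum _ _.
have E1 : \sum_i expi (- f (z i)) * expi (f (z i)) = #|I|%:R%:C.
  under eq_bigr do rewrite -expiD addNr expi0.
  by rewrite sumr_const rmorph_nat.
have E2 : normc (\sum_i expi (- f (z i)) * (g (z i) - expi (f (z i)))) <= #|I|%:R / 2.
  apply: le_trans (normc_sum _) _.
  apply: le_trans (_ : \sum_(i : I) 2^-1 <= _).
    by apply: ler_sum => i _; rewrite Normc.normcM normc_expi mul1r.
  by rewrite sumr_const mulr_natl.
have E3 : \sum_i expi (- f (z i)) * expi (f (z i)) =
  \sum_i expi (- f (z i)) * g (z i) +
  (- \sum_i expi (- f (z i)) * (g (z i) - expi (f (z i)))).
  by rewrite -sumrB; apply: eq_bigr => i _; ring.
have := normc_triangle (\sum_i expi (- f (z i)) * g (z i))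
  (- \sum_i expi (- f (z i)) * (g (z i) - expi (f (z i)))).
rewrite -E3 E1 normc_real normcN ger0_norm//; lra.
Qed.

(** The transform of the tent-like measure on c + h (p - q) is a squared
    Dirichlet sum up to a unimodular factor. *)
Lemma sum_expi_cell m M (theta h : R) (u c : 'cV[R]_m) :
  normc (\sum_(p : {ffun 'I_m -> 'I_M}) \sum_(q : {ffun 'I_m -> 'I_M})
    expi (theta + dotv u (c + h *: map_mx intr (freq p - freq q)))) =
  normc (\sum_(p : {ffun 'I_m -> 'I_M}) expi (dotv u (h *: map_mx intr (freq p)))) ^+ 2.
Proof.
have -> : \sum_(p : {ffun 'I_m -> 'I_M}) \sum_(q : {ffun 'I_m -> 'I_M})
    expi (theta + dotv u (c + h *: map_mx intr (freq p - freq q))) =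
  expi (theta + dotv u c) * \sum_(p : {ffun 'I_m -> 'I_M}) \sum_(q : {ffun 'I_m -> 'I_M})
   expi (dotv u (h *: map_mx intr (freq p)) - dotv u (h *: map_mx intr (freq q))).
  rewrite mulr_sumr; apply: eq_bigr => p _; rewrite mulr_sumr; apply: eq_bigr => q _.
  by rewrite -expiD map_mxB scalerBr dotvDr dotvBr addrA.
by rewrite Normc.normcM normc_expi mul1r sum_expi_diff normc_real ger0_norm// sqr_ge0.
Qed.

Lemma normr_freqB d N (p q : {ffun 'I_d -> 'I_N.+1}) j :
  `|((freq p - freq q) j 0)%:~R : R| <= N%:R.
Proof.
rewrite !mxE -intr_norm -[N%:R]/((Posz N)%:~R) ler_int.
have := ltn_ord (p j); have := ltn_ord (q j); lia.
Qed.

(** The factor in front of the A-norm is free of lambda, although the number of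
    test points in each cell is not. *)
Lemma A_norm_ge_cells k m (a : 'cV[R]_k -> 'cV[R]_m) (b : 'cV[R]_m -> 'cV[R]_m)
  (ha : of_class_A a) (hb : of_class_A b)
  (P : 'M[R]_m) (y0 c : 'cV[R]_m) (delta : R) (d0 : 0 < delta)
  (bP : forall y : 'cV[R]_m, (forall j, `|c j 0 - y j 0| < delta) -> b y = P *m y + y0)
  (lambda : R) (S L : nat) (B : int) (A : {set {ffun 'I_m -> 'I_L}})
  (X : {ffun 'I_m -> 'I_L} -> 'cV[R]_k) :
  (forall r, r \in A -> forall j,
     Num.floor (S%:R * (lambda *: (P^T *m a (X r))) j 0) = (r j)%:Z - B) ->
  ((#|A|%:R / 2)%:E <= ((8 * (3 + 32 * S%:R ^+ 2 / delta ^+ 2)) ^+ m)%:E *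
    A_norm (fun z : 'cV[R]_(k + m) => expi (lambda * phase a b z)))%E.
Proof.
move=> floorE; set K := 8 * _.
pose v r : 'cV[R]_m := lambda *: (P^T *m a (X r)).
have half0 : 0 < 2^-1 :> R by rewrite invr_gt0.
have [N NP] := fejer_approx (periodic_expi_phase lambda ha hb)
  (cbuc_expi_phase lambda ha hb) half0.
have [Mv MvP] : exists Mv : R, forall r j, `|v r j 0| <= Mv.
  exists (\sum_r \sum_j `|v r j 0|) => r j.
  rewrite (bigD1 r)//= (bigD1 j)//= -addrA lerDl addr_ge0 ?sumr_ge0// => i _.
  exact: sumr_ge0.
(* M is taken so large that the steps h (l - v r) are at most 1/2 for all the
   frequencies l of the Fejér mean. *)
pose M := Num.truncn (2 * delta * (N%:R + Mv)).
have MP : 2 * delta * (N%:R + Mv) <= M.+1%:R by rewrite ltW// truncnS_gt.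
pose h := delta / M.+1%:R.
have h0 : 0 < h by rewrite divr_gt0.
pose T := {ffun 'I_m -> 'I_M.+1}.
pose y (p q : T) : 'cV[R]_m := c + h *: map_mx intr (freq p - freq q).
pose z (i : 'I_#|A| * (T * T)) : 'cV[R]_(k + m) :=
  col_mx (X (enum_val i.1)) (y i.2.1 i.2.2).
have bE p q : b (y p q) = P *m y p q + y0.
  apply: bP => j; rewrite [y p q j 0]mxE opprD addNKr normrN mxE normrM gtr0_norm//.
  rewrite mxE; apply: le_lt_trans (ler_wpM2l (ltW h0) (normr_freqB p q j)) _.
  by rewrite /h mulrAC ltr_pdivrMr// ltr_pM2l// ltr_nat.
have m0 : 0 < M.+1%:R :> R by [].
have K0 : 0 <= K.
  apply: mulr_ge0 => //; apply: addr_ge0 => //.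
  by apply: divr_ge0; rewrite ?sqr_ge0//; apply: mulr_ge0; rewrite ?sqr_ge0.
have D0 : 0 <= K ^+ m * (M.+1%:R ^+ 2) ^+ m by rewrite mulr_ge0 ?exprn_ge0.
have := @A_norm_ge_points _ (fun z => lambda * phase a b z) _ z _ N D0 NP.
rewrite !card_prod card_ord card_ffun !card_ord => H.
have M2 : 0 < (M.+1%:R ^+ 2) ^+ m :> R by rewrite !exprn_gt0.
rewrite -(@lee_pmul2l _ ((M.+1%:R ^+ 2) ^+ m)%:E)// ?lte_fin//.
rewrite muleA -!EFinM [in leRHS]mulrC.
rewrite (_ : (M.+1%:R ^+ 2) ^+ m * (#|A|%:R / 2) =
   (#|A| * (M.+1 ^ m * M.+1 ^ m))%N%:R / 2); last first.
  by rewrite natrM natrM natrX exprAC expr2; ring.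
apply: H => p0 q0; set n := freq p0 - freq q0.
rewrite -(pair_bigA _ (fun r pq => expi (dotv (map_mx intr n) (z (r, pq)) -
  lambda * phase a b (z (r, pq)))))/=.
apply: le_trans (normc_sum _) _.
pose l := dsubmx n.
have small r : r \in A -> forall j, `|((l j 0)%:~R - v r j 0) * h| <= 2^-1.
  move=> rA j; rewrite normrM (gtr0_norm h0) /h mulrA ler_pdivrMr//.
  have : `|(l j 0)%:~R - v r j 0| <= N%:R + Mv.
    apply: le_trans (ler_normB _ _) (lerD _ (MvP r j)).
    rewrite /l mxE; exact: normr_freqB.
  move: MP; move: (M.+1%:R) => x; move: (`|_ - _|) (N%:R + Mv) => s t; nra.
apply: le_trans (dirichlet_cells d0 floorE small).
rewrite [leRHS]big_enum_val; apply: ler_sum => i _.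
rewrite -(pair_bigA _ (fun p q => expi (dotv (map_mx intr n) (z (i, (p, q))) -
  lambda * phase a b (z (i, (p, q))))))/=.
rewrite le_eqVlt; apply/orP; left; apply/eqP; set r := enum_val i.
rewrite -(@sum_expi_cell _ _ (dotv (map_mx intr (usubmx n)) (X r)
   - lambda * dotv (a (X r)) y0) h _ c).
congr normc; apply: eq_bigr => p _; apply: eq_bigr => q _; congr expi.
rewrite /phase /z /= !col_mxKu !col_mxKd bE (dotvDr (P *m y p q) y0) dotv_mulmx -/(y p q).
rewrite -[n in LHS]vsubmxK map_col_mx dotv_col_mx -/r -/l.
by rewrite dotvDl dotvNl /v dotvZl; ring.
Qed.

End LowerBound.

Theorem mainTheorem1 (R : realType) (k m : nat) (hk : (1 <= k)%N)
    (hm : (1 <= m)%N)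
    (a : 'cV[R]_k -> 'cV[R]_m) (b : 'cV[R]_m -> 'cV[R]_m)
    (ha : of_class_A a) (hb : of_class_A b)
    (J : set 'cV[R]_m) (hJ : domain J)
    (hJpi : J `<=` [set y : 'cV[R]_m | forall j : 'I_m, - pi <= y j 0 <= pi])
    (P : 'M[R]_m) (y0 : 'cV[R]_m) (hP : \det P != 0)
    (hbJ : forall y : 'cV[R]_m, J y -> b y = P *m y + y0) :
  exists c lambda0 : R,
    [/\ 0 < c, 0 < lambda0 &
      forall lambda : R, lambda0 <= `|lambda| ->
        (c%:E * covering_number (range a) (1 / `|lambda|)
         <= A_norm (fun z : 'cV[R]_(k + m) => expi (lambda * phase a b z)))%E].
Proof.
have [[y1 Jy1] oJ _] := hJ.
have [delta /= d0 dJ] : exists2 delta : R, 0 < delta &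
    forall y : 'cV[R]_m, (forall j, `|y1 j 0 - y j 0| < delta) -> J y.
  have /nbhs_ballP[delta /= d0 dP] : nbhs y1 J by exact: open_nbhs_nbhs.
  exists delta => // y yP; apply: dP; split=> // i j.
  by rewrite (ord1 j); exact: yP.
pose Q := invmx P^T; pose G := \sum_i \sum_j `|Q i j|.
(* G bounds the operator norm of the inverse of P^T from the sup norm to the
   Euclidean norm, so cells of side 1 / S pull back into balls of radius
   1 / |lambda|. *)
pose S := (Num.truncn G).+1.
have GS : G < S%:R by exact: truncnS_gt.
pose K : R := (8 * (3 + 32 * S%:R ^+ 2 / delta ^+ 2)) ^+ m.
have K0 : 0 < K.
  apply: exprn_gt0; apply: mulr_gt0 => //; apply: ltr_wpDr => //.
  by apply: divr_ge0; rewrite ?sqr_ge0//; apply: mulr_ge0; rewrite ?sqr_ge0.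
exists (2 * K)^-1, 1; split=> //; first by rewrite invr_gt0 mulr_gt0.
move=> lambda l1; have l0 : 0 < `|lambda| by exact: lt_le_trans l1.
have ln0 : lambda != 0 by rewrite -normr_gt0.
pose v x : 'cV[R]_m := lambda *: (P^T *m a x).
have [B vB] : exists B : nat, forall x j, `|(S%:R *: v x) j 0| <= B%:R.
  have [_ ba] := of_class_A_buc ha.
  have /choice[Ma MaP] : forall j, exists M, forall x, `|a x j 0| <= M.
    by move=> j; case: (ba j) => [[M]]; exists M.
  pose C := \sum_j \sum_i `|P^T j i| * Ma i.
  exists (Num.truncn (S%:R * (`|lambda| * C))).+1 => x j.
  apply: ltW; apply: le_lt_trans (truncnS_gt _).
  rewrite !mxE !normrM normr_nat !ler_wpM2l//.
  apply: le_trans (ler_norm_sum _ _ _) _.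
  have H j' : \sum_i `|P^T j' i * a x i 0| <= \sum_i `|P^T j' i| * Ma i.
    by apply: ler_sum => i _; rewrite normrM ler_wpM2l.
  apply: le_trans (H j) _; rewrite /C [leRHS](bigD1 j)//= lerDl sumr_ge0// => i _.
  by apply: le_trans (H i); exact: sumr_ge0.
have [A [X [AX Xcov]]] := grid_cells 0 vB.
have cov : Defs.covered_by (range a) (1 / `|lambda|) #|A|.
  exists (fun i => a (X (enum_val i))) => _ [x _ <-].
  have [r rA rx] := Xcov x.
  exists (enum_rank_in rA r) => //; rewrite /eball /= enum_rankK_in//.
  have aE : a x - a (X r) = Q *m (lambda^-1 *: (v x - v (X r))).
    rewrite /v -scalerBr -mulmxBr scalerA mulVf// scale1r mulKmx//.
    by rewrite unitmx_tr unitmxE unitfE.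
  rewrite aE; apply: le_lt_trans (@enorm_mulmx_le _ _ _ _ (S%:R^-1 * `|lambda|^-1) _) _.
    move=> j; rewrite mxE normrM normfV mulrC ler_wpM2r ?invr_ge0//.
    have S0 : 0 < S%:R :> R by [].
    rewrite -(ler_pM2l S0) mulfV ?gt_eqF// -[X in X * _ <= _](ger0_norm (ltW S0)) -normrM.
    have := rx j; set f1 := Num.floor _ => f12.
    have /andP[h1 h2] := floor_itv ((S%:R *: v x) j 0).
    have /andP[h3 h4] := floor_itv ((S%:R *: v (X r)) j 0).
    rewrite -/f1 in h1 h2; rewrite -f12 in h3 h4.
    have SE u : (S%:R *: v u) j 0 = S%:R * v u j 0 by rewrite mxE.
    move: h1 h2 h3 h4; rewrite !SE !rmorphD /=.
    by rewrite [(v x - _) j 0]mxE [(- v _) j 0]mxE ler_norml; lra.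
  rewrite mulrA div1r -[ltRHS]mul1r ltr_pM2r ?invr_gt0//.
  by rewrite ltr_pdivrMr// mul1r.
have covN : (covering_number (range a) (1 / `|lambda|) <= #|A|%:R%:E)%E.
  by apply: ereal_inf_lbound; exists #|A|.
have := @A_norm_ge_cells _ _ _ _ _ ha hb P y0 y1 delta d0
  (fun y yP => hbJ y (dJ y yP)) lambda S _ B%:Z A X.
have floorE r : r \in A -> forall j,
    Num.floor (S%:R * (lambda *: (P^T *m a (X r))) j 0) = (r j)%:Z - B%:Z.
  by move=> rA j; rewrite -(AX r rA j) [in RHS]mxE.
move=> /(_ floorE); rewrite -/K => H.
have c0 : 0 < (2 * K)^-1 by rewrite invr_gt0 mulr_gt0.
apply: le_trans (_ : (2 * K)^-1%:E * #|A|%:R%:E <= _)%E.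
  by apply: lee_wpmul2l => //; rewrite lee_fin ltW.
rewrite -(@lee_pmul2l _ K%:E)// ?lte_fin//; apply: le_trans H.
rewrite -!EFinM lee_fin le_eqVlt; apply/orP; left; apply/eqP.
by field; rewrite gt_eqF.
Qed.
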